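(* Let $\mathcal{E}$ be a $\lor$-free set of extension axioms and $\Gamma\to\Delta$ a sequent of eDT formulas. If the game $\mathsf{DB}$ over $\mathcal{E}$ has a proof (winning strategy from $\{\Gamma\mapsto1,\Delta\mapsto0\}$) of size $N$, then $\mathsf{eLDT}$ has a proof of $\Gamma\to\Delta$ of size polynomial in $N$ over some $\lor$-free set of extension axioms $\mathcal{E}'\supseteq\mathcal{E}$.
   Context: Syntax. Fix propositional variables $p,q,\dots$ and a disjoint set of extension variables $e_0,e_1,\dots$. eNDT formulas: $A,B ::= 0 \mid 1 \mid ApB \mid A\lor B \mid e_i$ with $p$ a propositional variable ($ApB$ means ''if $p$ then $B$ else $A$''); eDT formulas are those without $\lor$; $p$ is identified with $0p1$. A set of extension axioms is $\mathcal{E}=\{e_i\leftrightarrow E_i\}_{i<n}$ with each $E_i$ containing only extension variables among $e_0,\dots,e_{i-1}$; it is $\lor$-free if all $E_i$ are eDT. Sequents $\Gamma\to\Delta$ are pairs of finite lists of formulas. $\mathsf{LDT}$ has the rules: identity $A\to A$; cut; exchange, weakening, contraction on both sides; axiom $0\to$; from $\Gamma\to\Delta$ infer $\Gamma,1\to\Delta$; from $\Gamma\to\Delta$ infer $\Gamma\to\Delta,0$; axiom $\to1$; $p$-left (from $\Gamma,A\to\Delta,p$ and $\Gamma,p,B\to\Delta$ infer $\Gamma,ApB\to\Delta$); $p$-right (from $\Gamma\to\Delta,A,p$ and $\Gamma,p\to\Delta,B$ infer $\Gamma\to\Delta,ApB$). An $\mathsf{eLDT}$ proof over $\mathcal{E}$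 is a finite list of sequents, each a hypothesis $e_i\to E_i$ or $E_i\to e_i$ from $\mathcal{E}$ or obtained from earlier ones by an $\mathsf{LDT}$ rule; size = number of symbols. Simulation: $A\succeq_\mathcal{E} B$ is the smallest relation with: $A\succeq A$; $A\succeq C, A\succeq D\Rightarrow A\succeq C\lor D$; $A\succeq E_i\Rightarrow A\succeq e_i$; $A\succeq C, B\succeq D\Rightarrow ApB\succeq CpD$; $A_j\succeq B\Rightarrow A_0\lor A_1\succeq B$ ($j\in\{0,1\}$); $E_i\succeq B\Rightarrow e_i\succeq B$. Game $\mathsf{DB}$ over $\mathcal{E}$: queries are $P,Q::= A\mid\neg Q\mid Q\lor R\mid Q\land R$ with $A$ eDT. Simple contradictions: $\{0\mapsto1\}$, $\{1\mapsto0\}$; $\{A_0\mapsto b_0,A_1\mapsto b_1,p\mapsto i,A_0pA_1\mapsto c\}$ with $c\neq b_i$; sets inconsistent with the truth tables of $\neg,\lor,\land$ ($\{Q\mapsto b,\neg Q\mapsto b\}$, $\{Q_0\lor Q_1\mapsto0,Q_i\mapsto1\}$, $\{Q_0\lor Q_1\mapsto1,Q_0\mapsto0,Q_1\mapsto0\}$, $\{Q_0\land Q_1\mapsto0,Q_0\mapsto1,Q_1\mapsto1\}$, $\{Q_0\land Q_1\mapsto1,Q_i\mapsto0\}$); $\{e_i\mapsto b,E_i\mapsto1-b\}$; $\{A\mapsto0,B\mapsto1\}$ whenever $A\succeq_\mathcal{E}B$. A winning strategy from a state $S$ (set of assignments of Boolean values to queries) is a finite binary tree with internal nodes labelled by queries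 and outgoing edges labelled $0,1$, such that along every root-to-leaf path, $S$ plus the assignments made contains a simple contradiction. A $\mathsf{DB}$ proof of $\Gamma\to\Delta$ is a winning strategy from $\{\Gamma\mapsto1,\Delta\mapsto0\}$ (i.e.\ $A\mapsto1$ for $A\in\Gamma$, $B\mapsto0$ for $B\in\Delta$); its size is the number of symbols occurring in it.
   Formalization: The size N of the DB proof counts the symbols of the extension axioms and of the sequent Γ→Δ as well as those of the strategy tree; counting the tree alone makes the claim false (a one-leaf tree wins on 0,Γ→Δ for arbitrarily large Γ, Δ). *)

(* Defs.v *)
From HB Require Import structures.
From mathcomp Require Import all_boot all_order all_algebra.

Set Implicit Arguments.
Unset Strict Implicit.
Unset Printing Implicit Defensive.

(* [Dec A p B] is ApB, "if p then B else A". *)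
Inductive formula : Type :=
| Zero
| One
| Dec of formula & nat & formula
| Or of formula & formula
| Ext of nat.

Lemma formula_comparable : comparable formula.
Proof. move=> A B; rewrite /decidable; decide equality; exact: eq_comparable. Qed.

HB.instance Definition _ :=
  hasDecEq.Build formula (compareP formula_comparable).

Definition pvar (p : nat) : formula := Dec Zero p One.

Fixpoint is_eDT (A : formula) : bool :=
  match A with
  | Zero | One | Ext _ => true
  | Dec A _ B => is_eDT A && is_eDT B
  | Or _ _ => false
  end.

Fixpoint exts_below (n : nat) (A : formula) : bool :=
  match A with
  | Zero | One => true
  | Dec A _ B | Or A B => exts_below n A && exts_below n B
  | Ext i => i < n
  end.

Fixpoint formula_size (A : formula) : nat :=
  match A with
  | Zero | One | Ext _ => 1
  | Dec A _ B | Or A B => (formula_size A + formula_size B).+1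
  end.

(* The list [:: E_0; ...; E_(n-1)] stands for {e_i <-> E_i}_(i < n), so that
   [onth E i = Some A] says that e_i <-> A is one of the axioms. *)
Definition extensions := seq formula.

Definition extension_axioms (E : extensions) : Prop :=
  forall i A, onth E i = Some A -> exts_below i A.

Definition or_free (E : extensions) : bool := all is_eDT E.

Definition extensions_sub (E E' : extensions) : Prop :=
  forall i A, onth E i = Some A -> onth E' i = Some A.

(* e_i and <-> contribute two symbols to each axiom. *)
Definition extensions_size (E : extensions) : nat :=
  sumn [seq (formula_size A).+2 | A <- E].

Definition sequent := (seq formula * seq formula)%type.

Definition eDT_sequent (s : sequent) : bool :=
  all is_eDT s.1 && all is_eDT s.2.

(* The arrow contributes one symbol. *)
Definition sequent_size (s : sequent) : nat :=
  (sumn (map formula_size s.1) + sumn (map formula_size s.2)).+1.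

Inductive LDT_rule : seq sequent -> sequent -> Prop :=
| LDT_id A : LDT_rule [::] ([:: A], [:: A])
| LDT_cut G D A :
    LDT_rule [:: (G, D ++ [:: A]); (G ++ [:: A], D)] (G, D)
| LDT_exchange_l G G' D A B :
    LDT_rule [:: (G ++ [:: A; B] ++ G', D)] (G ++ [:: B; A] ++ G', D)
| LDT_exchange_r G D D' A B :
    LDT_rule [:: (G, D ++ [:: A; B] ++ D')] (G, D ++ [:: B; A] ++ D')
| LDT_weak_l G D A : LDT_rule [:: (G, D)] (G ++ [:: A], D)
| LDT_weak_r G D A : LDT_rule [:: (G, D)] (G, D ++ [:: A])
| LDT_contr_l G D A : LDT_rule [:: (G ++ [:: A; A], D)] (G ++ [:: A], D)
| LDT_contr_r G D A : LDT_rule [:: (G, D ++ [:: A; A])] (G, D ++ [:: A])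
| LDT_zero_l : LDT_rule [::] ([:: Zero], [::])
| LDT_one_l G D : LDT_rule [:: (G, D)] (G ++ [:: One], D)
| LDT_zero_r G D : LDT_rule [:: (G, D)] (G, D ++ [:: Zero])
| LDT_one_r : LDT_rule [::] ([::], [:: One])
| LDT_dec_l G D A p B :
    LDT_rule [:: (G ++ [:: A], D ++ [:: pvar p]); (G ++ [:: pvar p; B], D)]
      (G ++ [:: Dec A p B], D)
| LDT_dec_r G D A p B :
    LDT_rule [:: (G, D ++ [:: A; pvar p]); (G ++ [:: pvar p], D ++ [:: B])]
      (G, D ++ [:: Dec A p B]).

Inductive extension_hyp (E : extensions) : sequent -> Prop :=
| hyp_unfold i A : onth E i = Some A -> extension_hyp E ([:: Ext i], [:: A])
| hyp_fold i A : onth E i = Some A -> extension_hyp E ([:: A], [:: Ext i]).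

Definition eLDT_derivation (E : extensions) (pi : seq sequent) : Prop :=
  forall pi1 s pi2, pi = pi1 ++ s :: pi2 ->
    eDT_sequent s /\
    (extension_hyp E s \/
     exists prems, LDT_rule prems s /\ {subset prems <= pi1}).

Definition eLDT_proof (E : extensions) (pi : seq sequent) (s : sequent) : Prop :=
  eLDT_derivation E pi /\ exists pi0, pi = rcons pi0 s.

Definition eLDT_size (pi : seq sequent) : nat := sumn (map sequent_size pi).

Inductive simulates (E : extensions) : formula -> formula -> Prop :=
| sim_refl A : simulates E A A
| sim_or_r A C D :
    simulates E A C -> simulates E A D -> simulates E A (Or C D)
| sim_ext_r A i Ei :
    onth E i = Some Ei -> simulates E A Ei -> simulates E A (Ext i)
| sim_dec A B C D p :
    simulates E A C -> simulates E B D ->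
    simulates E (Dec A p B) (Dec C p D)
| sim_or_l0 A0 A1 B : simulates E A0 B -> simulates E (Or A0 A1) B
| sim_or_l1 A0 A1 B : simulates E A1 B -> simulates E (Or A0 A1) B
| sim_ext_l i Ei B :
    onth E i = Some Ei -> simulates E Ei B -> simulates E (Ext i) B.

Inductive query : Type :=
| QForm of formula
| QNot of query
| QOr of query & query
| QAnd of query & query.

Lemma query_comparable : comparable query.
Proof. move=> P Q; rewrite /decidable; decide equality; exact: eq_comparable. Qed.

HB.instance Definition _ := hasDecEq.Build query (compareP query_comparable).

Fixpoint query_eDT (Q : query) : bool :=
  match Q with
  | QForm A => is_eDT A
  | QNot Q => query_eDT Q
  | QOr Q R | QAnd Q R => query_eDT Q && query_eDT R
  end.

Fixpoint query_size (Q : query) : nat :=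
  match Q with
  | QForm A => formula_size A
  | QNot Q => (query_size Q).+1
  | QOr Q R | QAnd Q R => (query_size Q + query_size R).+1
  end.

(* A finite set of assignments, listed; only membership matters. *)
Definition state := seq (query * bool).

Inductive simple_contradiction (E : extensions) : state -> Prop :=
| sc_zero : simple_contradiction E [:: (QForm Zero, true)]
| sc_one : simple_contradiction E [:: (QForm One, false)]
| sc_dec A0 A1 p b0 b1 i c :
    c <> (if i then b1 else b0) ->
    simple_contradiction E
      [:: (QForm A0, b0); (QForm A1, b1); (QForm (pvar p), i);
          (QForm (Dec A0 p A1), c)]
| sc_not Q b : simple_contradiction E [:: (Q, b); (QNot Q, b)]
| sc_or_false0 Q0 Q1 :
    simple_contradiction E [:: (QOr Q0 Q1, false); (Q0, true)]
| sc_or_false1 Q0 Q1 :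
    simple_contradiction E [:: (QOr Q0 Q1, false); (Q1, true)]
| sc_or_true Q0 Q1 :
    simple_contradiction E [:: (QOr Q0 Q1, true); (Q0, false); (Q1, false)]
| sc_and_false Q0 Q1 :
    simple_contradiction E [:: (QAnd Q0 Q1, false); (Q0, true); (Q1, true)]
| sc_and_true0 Q0 Q1 :
    simple_contradiction E [:: (QAnd Q0 Q1, true); (Q0, false)]
| sc_and_true1 Q0 Q1 :
    simple_contradiction E [:: (QAnd Q0 Q1, true); (Q1, false)]
| sc_ext i Ei b :
    onth E i = Some Ei ->
    simple_contradiction E [:: (QForm (Ext i), b); (QForm Ei, ~~ b)]
| sc_sim A B :
    simulates E A B ->
    simple_contradiction E [:: (QForm A, false); (QForm B, true)].

Definition contradictory (E : extensions) (S : state) : Prop :=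
  exists C, simple_contradiction E C /\ {subset C <= S}.

(* In [Node Q t0 t1], t0 and t1 hang below the edges labelled 0 and 1. *)
Inductive strategy : Type :=
| Leaf
| Node of query & strategy & strategy.

Fixpoint strategy_eDT (t : strategy) : bool :=
  match t with
  | Leaf => true
  | Node Q t0 t1 => [&& query_eDT Q, strategy_eDT t0 & strategy_eDT t1]
  end.

Fixpoint winning (E : extensions) (S : state) (t : strategy) : Prop :=
  match t with
  | Leaf => contradictory E S
  | Node Q t0 t1 =>
      winning E ((Q, false) :: S) t0 /\ winning E ((Q, true) :: S) t1
  end.

(* Node labels and the two edge labels. *)
Fixpoint strategy_size (t : strategy) : nat :=
  match t with
  | Leaf => 0
  | Node Q t0 t1 => (query_size Q + strategy_size t0 + strategy_size t1).+2
  end.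

Definition initial_state (s : sequent) : state :=
  [seq (QForm A, true) | A <- s.1] ++ [seq (QForm B, false) | B <- s.2].

Definition DB_proof (E : extensions) (t : strategy) (s : sequent) : Prop :=
  strategy_eDT t /\ winning E (initial_state s) t.

(* A DB proof consists of the axioms it is over, the initial state and the
   tree; all three are counted.  The tree alone would not do: the leaf tree
   can win using a simulation A >= B whose derivation runs through all of E,
   and then every eLDT proof has to use those axioms; similarly, any eLDT
   proof contains its end sequent. *)
Definition DB_size (E : extensions) (t : strategy) (s : sequent) : nat :=
  extensions_size E + sequent_size s + strategy_size t.

(* Main.v *)
Require Import Defs.
From mathcomp Require Import all_boot all_order all_algebra.
From mathcomp Require Import zify.
From Stdlib Require Import Classical_Prop.

Set Implicit Arguments.
Unset Strict Implicit.
Unset Printing Implicit Defensive.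

(**
A Boolean combination of eDT formulas is itself computed by a deterministic
branching program: write [Q; R0, R1] for a program of "if Q then R1 else R0".
For a formula A, redirect the sinks of A, and of a fresh copy of all the
extension axioms, to R0 and R1; then [~Q; R0, R1] is [Q; R1, R0],
[P \/ Q; R0, R1] is [P; [Q; R0, R1], R1] and [P /\ Q; R0, R1] is
[P; R0, [Q; R0, R1]], the inner program being named by a new extension
variable so that formulas stay small.  Every query Q is replaced by
[Q; 0, 1], and the strategy becomes a tree of cuts.

At the leaves one needs short proofs for the simple contradictions.  Those
about connectives follow from a single principle: two programs [Q; R0, R1] and
[Q; S0, S1] with the same Q reach corresponding sinks, so a sequent containing
both follows from the one with R0, S0 and the one with R1, S1 in their place.
Its proof is linear in Q because each extension variable is handled once, and
it is uniform in the sides of the sequent on which the two programs stand.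
For a simulation A >= B one proves D -> C for all pairs C >= D of
subformulas of A, B and the axioms, in an order that decreases when an
extension variable is unfolded.
*)

(* Memberships in the context slow [lia] down, so only inequalities are kept. *)
Ltac nat_lia :=
  repeat match goal with
  | H : ?P |- _ =>
    lazymatch type of P with
    | Prop =>
      lazymatch P with
      | is_true (leq _ _) => fail
      | @eq nat _ _ => fail
      | _ => clear H
      end
    end
  end; lia.

(** * Derivations with a line count *)

Section Lines.

Variables (T : eqType) (step : seq T -> T -> Prop).

Fixpoint valid (l pi : seq T) : Prop :=
  if pi is s :: pi' then
    (exists2 prems, step prems s & {subset prems <= l}) /\ valid (s :: l) pi'
  else True.

(** Only lines are counted. The step relations used below bound the size of each line, so a line
    count becomes a symbol count after one multiplication. *)
Definition ent (c : nat) (l l' : seq T) : Prop :=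
  exists pi, [/\ valid l pi, size pi <= c & {subset l' <= pi ++ l}].

Lemma valid_mono l1 l2 pi : {subset l1 <= l2} -> valid l1 pi -> valid l2 pi.
Proof.
elim: pi l1 l2 => //= s pi IH l1 l2 sub [[prems st sp] v]; split.
  by exists prems => // x /sp /sub.
by apply: IH v => x; rewrite !inE => /orP[-> //|/sub ->]; rewrite orbT.
Qed.

Lemma valid_cat l pi1 pi2 :
  valid l pi1 -> valid (pi1 ++ l) pi2 -> valid l (pi1 ++ pi2).
Proof.
elim: pi1 l => //= s pi1 IH l [st v1] v2; split=> //; apply: IH => //.
by apply: valid_mono v2 => x; rewrite !inE !mem_cat !inE orbCA.
Qed.

Lemma valid_catl l pi1 pi2 : valid l (pi1 ++ pi2) -> valid l pi1.
Proof. by elim: pi1 l => //= s pi1 IH l [st /IH]. Qed.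

Lemma valid_split l pi1 s pi2 :
  valid l (pi1 ++ s :: pi2) ->
  exists2 prems, step prems s & {subset prems <= pi1 ++ l}.
Proof.
elim: pi1 l => [|x pi1 IH] l /= [st v]; first by [].
have [prems st' sub] := IH _ v; exists prems => // y /sub.
by rewrite !(inE, mem_cat) orbCA.
Qed.

Lemma ent_mono c c' l l' m m' :
  ent c l m -> c <= c' -> {subset l <= l'} -> {subset m' <= m} ->
  ent c' l' m'.
Proof.
move=> [pi [v sz sub]] cc ll mm; exists pi; split.
- exact: valid_mono v.
- exact: leq_trans cc.
- by move=> x /mm /sub; rewrite !mem_cat => /orP[->//|/ll ->]; rewrite orbT.
Qed.

Lemma ent_sub l m : {subset m <= l} -> ent 0 l m.
Proof. by move=> sub; exists [::]. Qed.

Lemma ent_trans c1 c2 l m1 m2 :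
  ent c1 l m1 -> ent c2 (m1 ++ l) m2 -> ent (c1 + c2) l (m1 ++ m2).
Proof.
move=> [p1 [v1 s1 b1]] [p2 [v2 s2 b2]]; exists (p1 ++ p2).
have sub12: {subset m1 ++ l <= p1 ++ l}.
  by move=> x; rewrite mem_cat => /orP[/b1 //|]; rewrite mem_cat orbC => ->.
split.
- by apply: valid_cat => //; apply: valid_mono v2.
- by rewrite size_cat leq_add.
move=> x; rewrite mem_cat => /orP[/b1|/b2]; rewrite !mem_cat.
  by move=> /orP[->//|->]; rewrite !orbT.
case/or3P=> [->|/b1|->]; rewrite ?orbT //.
by rewrite mem_cat => /orP[->//|->]; rewrite !orbT.
Qed.

Lemma ent_step c l prems s : step prems s -> ent c l prems -> ent c.+1 l [:: s].
Proof.
move=> st [pi [v sz sub]]; exists (rcons pi s); rewrite -cats1; split.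
- by apply: valid_cat => //=; split=> //; exists prems.
- by rewrite size_cat addn1 ltnS.
- by move=> x; rewrite !(inE, mem_cat) => ->; rewrite orbT.
Qed.

Lemma ent_cons c1 c2 l s m :
  ent c1 l [:: s] -> ent c2 l m -> ent (c1 + c2) l (s :: m).
Proof.
move=> e1 e2; rewrite -cat1s; apply: ent_trans => //.
by apply: (ent_mono e2) => // x xl; rewrite mem_cat xl orbT.
Qed.

Lemma ent_have c1 c2 l s m :
  ent c1 l [:: s] -> ent c2 (s :: l) m -> ent (c1 + c2) l m.
Proof.
move=> e1 e2; apply: (ent_mono (ent_trans e1 e2)) => // x xm.
by rewrite mem_cat xm orbT.
Qed.

Lemma ent_le c c' l m : ent c l m -> c <= c' -> ent c' l m.
Proof. by move=> e cc; apply: (ent_mono e). Qed.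

Lemma ent_weak c l l' m : {subset l <= l'} -> ent c l m -> ent c l' m.
Proof. by move=> ll e; apply: (ent_mono e). Qed.

(* Each member is derived once, from members of smaller rank: this is where
   dag-like sharing enters. *)
Lemma ent_family (I : eqType) (r : I -> nat) (P : I -> Prop) (st : I -> T)
    (c : nat) (base : seq T) (l : seq I) :
  (forall x l', x \in l -> P x -> {subset base <= l'} ->
     (forall y, y \in l -> P y -> r y < r x -> st y \in l') ->
     ent c l' [:: st x]) ->
  exists2 l', ent (c * size l) base l' &
    forall x, x \in l -> P x -> st x \in l'.
Proof.
have [n] := ubnP (size l); elim: n l => // n IH l szl H.
have [->|nel] := eqVneq l [::]; first by exists [::] => //; rewrite muln0; apply: ent_sub.
(* A member of maximal rank is derived last: no other member can need it, so the induction
   hypothesis applies to the list without it. *)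
have [x xl xmax] : exists2 x, x \in l & forall y, y \in l -> r y <= r x.
  elim: l nel {szl H} => // a [|b l] IHl _.
    by exists a; rewrite ?mem_head // => y; rewrite inE => /eqP->.
  have [//|x xl mx] := IHl.
  case: (leqP (r a) (r x)) => ax.
    exists x; first by rewrite inE xl orbT.
    by move=> y; rewrite inE => /orP[/eqP->|/mx].
  exists a; first exact: mem_head.
  move=> y; rewrite inE => /orP[/eqP->//|/mx yx].
  by rewrite (leq_trans yx) // ltnW.
have pl := perm_to_rem xl.
have memE y : (y \in l) = (y == x) || (y \in rem x l).
  by rewrite (perm_mem pl) inE.
have szE : size l = (size (rem x l)).+1 by rewrite (perm_size pl).
have [||l' e el] := IH (rem x l).
- by move: szl; rewrite szE.
- move=> y m yl Py bm Hm; apply: H => //; first by rewrite memE yl orbT.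
  move=> z zl Pz rz; apply: Hm => //.
  move: zl; rewrite memE => /orP[/eqP zx|//].
  by have := xmax y; rewrite memE yl orbT => /(_ isT); rewrite -zx leqNgt rz.
(* [P] will be the simulation relation, for which no decision procedure is set up; a member outside
   [P] asks for no line. *)
have [Px|nPx] := classic (P x); last first.
  exists l'; first by apply: (ent_le e); rewrite leq_mul2l szE leqnSn orbT.
  by move=> y; rewrite memE => /orP[/eqP->|]; [|exact: el].
exists (l' ++ [:: st x]).
  have -> : c * size l = c * size (rem x l) + c by rewrite szE mulnS addnC.
  apply: ent_trans => //; apply: H => //.
    by move=> y yb; rewrite mem_cat yb orbT.
  move=> y yl Py ryx; rewrite mem_cat el //.
  move: yl; rewrite memE => /orP[/eqP yx|//].
  by rewrite yx ltnn in ryx.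
move=> y; rewrite memE mem_cat inE => /orP[/eqP->|yl Py].
  by rewrite eqxx orbT.
by rewrite el.
Qed.

End Lines.

(** Each line is replaced by a block of at most [k] lines. As the derivation has no hypotheses,
    every premise is itself a derived line, so [ok] may be assumed of the premises when a step is
    translated. *)
Lemma ent_translate (T U : eqType) (step1 : seq T -> T -> Prop)
    (step2 : seq U -> U -> Prop) (ok : pred T) (h : T -> U) (k c : nat)
    (m : seq T) :
  (forall prems s, step1 prems s -> ok s) ->
  (forall prems s, step1 prems s -> all ok prems ->
     ent step2 k (map h prems) [:: h s]) ->
  ent step1 c [::] m -> ent step2 (k * c) [::] (map h m).
Proof.
move=> okS tr [pi [v szc sub]].
suff main l : all ok l -> valid step1 l pi ->
    ent step2 (k * size pi) (map h l) (map h pi).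
  have /= e := main [::] isT v.
  apply: (ent_mono e) => //; first by rewrite leq_mul2l szc orbT.
  move=> _ /mapP[y /sub yp ->].
  by apply: map_f; rewrite cats0 in yp.
elim: pi l {v szc sub} => [|s pi IH] l okl /=; first by move=> _; rewrite muln0; apply: ent_sub.
move=> [[prems st sp] v]; rewrite mulnS -cat1s; apply: ent_trans.
  apply: (ent_weak _ (tr _ _ st _)).
    by move=> _ /mapP[y /sp yl ->]; apply: map_f.
  by apply/allP => y /sp; apply/allP.
by apply: (IH (s :: l)) => //=; rewrite okl (okS _ _ st).
Qed.

(** * A calculus of signed formulas *)

(* [(A, true)] stands for A in the antecedent and [(A, false)] for A in the
   succedent, as for the assignments of the game. *)
Definition sstate := seq (formula * bool).

Definition weight (S : sstate) : nat := sumn [seq formula_size x.1 | x <- S].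

Definition ok (m : nat) (S : sstate) : bool :=
  all (fun x => is_eDT x.1) S && (weight S <= m).

(** States matter only up to membership: [srule_weak] absorbs exchange, weakening and contraction,
    and [srule_dec] keeps its principal formula in the premises. With signs, each left and right
    rule pair becomes a single rule. *)
Inductive srule (E : extensions) : seq sstate -> sstate -> Prop :=
| srule_weak S S' : {subset S <= S'} -> srule E [:: S] S'
| srule_id A S : (A, true) \in S -> (A, false) \in S -> srule E [::] S
| srule_zero S : (Zero, true) \in S -> srule E [::] S
| srule_one S : (One, false) \in S -> srule E [::] S
| srule_cut A S : srule E [:: (A, true) :: S; (A, false) :: S] S
| srule_dec A p B b S : (Dec A p B, b) \in S ->
    srule E [:: (A, b) :: (pvar p, false) :: S; (B, b) :: (pvar p, true) :: S] S
| srule_ext i A b S :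
    onth E i = Some A -> (Ext i, b) \in S -> (A, ~~ b) \in S -> srule E [::] S.

Definition sstep (E : extensions) (m : nat) (prems : seq sstate) (S : sstate) :=
  srule E prems S /\ ok m S.

Section Signed.

Variables (E : extensions) (m : nat).

Implicit Types (S : sstate) (l : seq sstate).

Local Notation prove c l S := (ent (sstep E m) c l [:: S]).

Lemma ok_cons x S : ok m (x :: S) -> ok m S.
Proof.
by rewrite /ok /weight /= => /andP[/andP[_ ->]] /=; apply: leq_trans (leq_addl _ _).
Qed.

Lemma ok_sign A b b' S : ok m ((A, b) :: S) -> ok m ((A, b') :: S).
Proof. by []. Qed.

Lemma prove_axiom S l : srule E [::] S -> ok m S -> prove 1 l S.
Proof. by move=> r oS; apply: (ent_step (prems := [::])) => //; apply: ent_sub. Qed.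

Lemma prove_const (b : bool) S l :
  ((if b then Zero else One), b) \in S -> ok m S -> prove 1 l S.
Proof.
by case: b => H; apply: prove_axiom; [apply: srule_zero|apply: srule_one].
Qed.

Lemma prove_id A b S l :
  (A, b) \in S -> (A, ~~ b) \in S -> ok m S -> prove 1 l S.
Proof. by case: b => H1 H2; apply: prove_axiom; apply: (@srule_id _ A). Qed.

Lemma prove_hyp S S' l : S \in l -> {subset S <= S'} -> ok m S' -> prove 1 l S'.
Proof.
move=> Sl sub oS; apply: (ent_step (prems := [:: S])).
  by split=> //; apply: srule_weak.
by apply: ent_sub => x; rewrite inE => /eqP->.
Qed.

Lemma prove_weak c S S' l :
  prove c l S -> {subset S <= S'} -> ok m S' -> prove c.+1 l S'.
Proof. by move=> e sub oS; apply: ent_step e; split=> //; apply: srule_weak. Qed.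

Lemma prove_cut c1 c2 A S l :
  ok m ((A, true) :: S) ->
  prove c1 l ((A, true) :: S) -> prove c2 l ((A, false) :: S) ->
  prove (c1 + c2).+1 l S.
Proof.
move=> oS e1 e2; apply: ent_step (ent_cons e1 e2).
by split; [apply: srule_cut|apply: ok_cons oS].
Qed.

Lemma prove_dec c1 c2 A p B b S l :
  (Dec A p B, b) \in S -> ok m S ->
  prove c1 l ((A, b) :: (pvar p, false) :: S) ->
  prove c2 l ((B, b) :: (pvar p, true) :: S) ->
  prove (c1 + c2).+1 l S.
Proof.
move=> H oS e1 e2; apply: ent_step (ent_cons e1 e2).
by split=> //; apply: srule_dec.
Qed.

(** This is a cut on the body [A], where the branch with the opposite sign is an instance of the
    extension axiom; [b] decides which branch that is. *)
Lemma prove_unfold c i A b S l :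
  onth E i = Some A -> (Ext i, b) \in S -> ok m ((A, b) :: S) ->
  prove c l ((A, b) :: S) -> prove c.+2 l S.
Proof.
move=> EA H oS e.
have ax : prove 1 l ((A, ~~ b) :: S).
  apply: prove_axiom => //.
  by apply: (srule_ext EA (b := b)); rewrite inE ?H ?eqxx ?orbT.
case: b {H} oS e ax => oS e ax.
  by have := prove_cut oS e ax; rewrite addn1.
by have := prove_cut (ok_sign true oS) ax e.
Qed.

(* Opposite signs give monotonicity of the decision connective; equal signs
   say that both decisions branch on the same p. *)
Lemma prove_dec2 A1 B1 A2 B2 p b1 b2 S l :
  [&& is_eDT A1, is_eDT B1, is_eDT A2, is_eDT B2 & ok m S] ->
  weight S + 2 * (formula_size A1 + formula_size B1 + formula_size A2
    + formula_size B2) + 8 <= m ->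
  (A1, b1) :: (A2, b2) :: S \in l -> (B1, b1) :: (B2, b2) :: S \in l ->
  prove 7 l ((Dec A1 p B1, b1) :: (Dec A2 p B2, b2) :: S).
Proof.
rewrite /ok /weight => eS szS lA lB.
(* Both decisions are split, the second inside each branch of the first. The two mixed branches
   contain [pvar p] with both signs, the other two are the given lines. *)
apply: (@prove_dec 3 3 A1 p B1 b1); rewrite ?mem_head //.
- by rewrite /ok /weight /=; lia.
- apply: (@prove_dec 1 1 A2 p B2 b2); rewrite ?inE ?eqxx ?orbT //.
  + by rewrite /ok /weight /=; lia.
  + apply: prove_hyp lA _ _; last by rewrite /ok /weight /=; lia.
    by move=> x; rewrite !inE => /or3P[] ->; rewrite ?orbT.
  + apply: (@prove_id (pvar p) true); rewrite ?inE ?eqxx ?orbT //.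
    by rewrite /ok /weight /=; lia.
- apply: (@prove_dec 1 1 A2 p B2 b2); rewrite ?inE ?eqxx ?orbT //.
  + by rewrite /ok /weight /=; lia.
  + apply: (@prove_id (pvar p) true); rewrite ?inE ?eqxx ?orbT //.
    by rewrite /ok /weight /=; lia.
  + apply: prove_hyp lB _ _; last by rewrite /ok /weight /=; lia.
    by move=> x; rewrite !inE => /or3P[] ->; rewrite ?orbT.
Qed.

Lemma prove_unfold2 c i1 A1 b1 i2 A2 b2 S l :
  onth E i1 = Some A1 -> onth E i2 = Some A2 ->
  [&& is_eDT A1, is_eDT A2 & ok m S] ->
  weight S + formula_size A1 + formula_size A2 + 2 <= m ->
  prove c l ((A1, b1) :: (A2, b2) :: S) ->
  prove (c + 5) l ((Ext i1, b1) :: (Ext i2, b2) :: S).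
Proof.
rewrite /ok /weight => E1 E2 eS szS e.
have -> : c + 5 = c.+1.+4 by lia.
apply: (prove_unfold (b := b2) E2); rewrite ?inE ?eqxx ?orbT //.
  by rewrite /ok /weight /=; lia.
apply: (prove_unfold (b := b1) E1); rewrite ?inE ?eqxx ?orbT //.
  by rewrite /ok /weight /=; lia.
apply: (prove_weak e); last by rewrite /ok /weight /=; lia.
by move=> x; rewrite !inE => /or3P[] ->; rewrite ?orbT.
Qed.

End Signed.

(** * Boolean combinations as decision programs *)

(* Redirects the 0-sinks of the branching program A to R0, its 1-sinks to R1,
   and the program named e_i to the one named e_(f i). *)
Fixpoint redirect (f : nat -> nat) (R0 R1 A : formula) : formula :=
  match A with
  | Zero => R0
  | One => R1
  | Dec A p B => Dec (redirect f R0 R1 A) p (redirect f R0 R1 B)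
  | Or A B => Or (redirect f R0 R1 A) (redirect f R0 R1 B)
  | Ext i => Ext (f i)
  end.

(** Sinks are replaced only by constants or extension variables, so that redirecting a program does
    not change its size. *)
Definition atomic (R : formula) : bool := formula_size R == 1.

Fixpoint exts (A : formula) : seq nat :=
  match A with
  | Zero | One => [::]
  | Dec A _ B | Or A B => exts A ++ exts B
  | Ext i => [:: i]
  end.

Lemma exts_belowE n A : exts_below n A = all (fun i => i < n) (exts A).
Proof.
by elim: A => //= [A -> p B ->|A -> B ->|i]; rewrite ?all_cat //= andbT.
Qed.

Lemma exts_below_leq n n' A : n <= n' -> exts_below n A -> exts_below n' A.
Proof.
move=> nn; rewrite !exts_belowE => /allP H.
by apply/allP => i /H /leq_trans; apply.
Qed.

Lemma size_exts A : size (exts A) <= formula_size A.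
Proof.
by elim: A => //= [A HA p B HB|A HA B HB]; rewrite size_cat; lia.
Qed.

Lemma formula_size_gt0 A : 0 < formula_size A.
Proof. by case: A. Qed.

Lemma atomic_eDT R : atomic R -> is_eDT R.
Proof.
rewrite /atomic; case: R => //= [A p B|A B];
  by have := formula_size_gt0 A; have := formula_size_gt0 B; lia.
Qed.

Lemma redirect_size f R0 R1 A :
  atomic R0 -> atomic R1 -> formula_size (redirect f R0 R1 A) = formula_size A.
Proof.
move=> /eqP a0 /eqP a1.
by elim: A => //= [A -> p B ->|A -> B ->].
Qed.

Lemma redirect_eDT f R0 R1 A :
  atomic R0 -> atomic R1 -> is_eDT (redirect f R0 R1 A) = is_eDT A.
Proof.
move=> /atomic_eDT a0 /atomic_eDT a1.
by elim: A => //= A -> p B ->.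
Qed.

Lemma redirect_id A : redirect id Zero One A = A.
Proof. by elim: A => //= [A -> p B ->|A -> B ->]. Qed.

Lemma redirect_exts_below f R0 R1 n n' A :
  (forall i, i < n -> f i < n') -> exts_below n' R0 -> exts_below n' R1 ->
  exts_below n A -> exts_below n' (redirect f R0 R1 A).
Proof.
move=> Hf r0 r1.
by elim: A => //= [A IA p B IB|A IA B IB] /andP[/IA -> /IB ->].
Qed.

Lemma onth_some (T : Type) (x0 : T) s i :
  i < size s -> onth s i = Some (nth x0 s i).
Proof. by elim: s i => [|x s IH] [|i] //= /IH. Qed.

(* Beyond [size E] the default value of [nth] gives e_i the definition 0. *)
Definition copied (E E' : extensions) (M : nat) (f : nat -> nat)
    (R0 R1 : formula) : Prop :=
  forall i, i < M -> onth E' (f i) = Some (redirect f R0 R1 (nth Zero E i)).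

(* X is a program for "if Q then R1 else R0". *)
Fixpoint compiled (E E' : extensions) (M : nat) (Q : query)
    (R0 R1 X : formula) : Prop :=
  match Q with
  | QForm A => exists2 f, copied E E' M f R0 R1 & X = redirect f R0 R1 A
  | QNot P => compiled E E' M P R1 R0 X
  | QOr P P' => exists k Y, [/\ onth E' k = Some Y, compiled E E' M P' R0 R1 Y
      & compiled E E' M P (Ext k) R1 X]
  | QAnd P P' => exists k Y, [/\ onth E' k = Some Y, compiled E E' M P' R0 R1 Y
      & compiled E E' M P R0 (Ext k) X]
  end.

Fixpoint query_exts_below (M : nat) (Q : query) : bool :=
  match Q with
  | QForm A => exts_below M A
  | QNot P => query_exts_below M P
  | QOr P P' | QAnd P P' => query_exts_below M P && query_exts_below M P'
  end.

(** In a binary connective the second program is hidden behind the atom [Ext k], so only the first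
    contributes to [X]. *)
Lemma compiled_size E E' M Q R0 R1 X :
  atomic R0 -> atomic R1 -> compiled E E' M Q R0 R1 X -> formula_size X <= query_size Q.
Proof.
elim: Q R0 R1 X => [A|P IP|P IP Q IQ|P IP Q IQ] R0 R1 X a0 a1 /=.
- by move=> [f _ ->]; rewrite redirect_size.
- by move=> /IP; rewrite a0 a1 => /(_ isT isT); apply: leqW.
- by move=> [k [Y [_ _ /IP]]]; rewrite a1 => /(_ isT isT); lia.
- by move=> [k [Y [_ _ /IP]]]; rewrite a0 => /(_ isT isT); lia.
Qed.

Lemma compiled_eDT E E' M Q R0 R1 X :
  atomic R0 -> atomic R1 -> query_eDT Q -> compiled E E' M Q R0 R1 X -> is_eDT X.
Proof.
elim: Q R0 R1 X => [A|P IP|P IP Q IQ|P IP Q IQ] R0 R1 X a0 a1 /=.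
- by move=> eA [f _ ->]; rewrite redirect_eDT.
- by move=> eP /IP; apply.
- by move=> /andP[eP eQ] [k [Y [_ _ /IP]]]; apply.
- by move=> /andP[eP eQ] [k [Y [_ _ /IP]]]; apply.
Qed.

(** * Parallel traversal of two programs for the same query *)

Section Synchronisation.

Variables (E E' : extensions) (M N m : nat).
Hypotheses (wfE : extension_axioms E) (ofE : or_free E) (EM : size E <= M).
Hypotheses (EN : size E <= N)
  (sizeE : forall A, A \in E -> formula_size A <= N).

Implicit Types (S : sstate) (l : seq sstate).

Local Notation prove c l S := (ent (sstep E' m) c l [:: S]).
Local Notation compiled := (compiled E E' M).
Local Notation copied := (copied E E' M).

Lemma size_nth_ext i : 0 < N -> formula_size (nth Zero E i) <= N.
Proof.
move=> N0; case: (ltnP i (size E)) => iE; last by rewrite nth_default.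
by apply: sizeE; apply: mem_nth.
Qed.

Lemma eDT_nth_ext i : is_eDT (nth Zero E i).
Proof.
case: (ltnP i (size E)) => iE; last by rewrite nth_default.
by apply: (allP ofE); apply: mem_nth.
Qed.

(** Both copies of [A] are descended together. Pairs of sinks and of extension variables are
    hypotheses, and each decision node costs the 7 lines of [prove_dec2]. *)
Lemma sync_redirect f1 f2 R0 R1 T0 T1 b1 b2 S l A :
  atomic R0 -> atomic R1 -> atomic T0 -> atomic T1 -> is_eDT A ->
  ok m S -> weight S + 4 * formula_size A + 8 <= m ->
  (R0, b1) :: (T0, b2) :: S \in l -> (R1, b1) :: (T1, b2) :: S \in l ->
  (forall i, i \in exts A -> (Ext (f1 i), b1) :: (Ext (f2 i), b2) :: S \in l) ->
  prove (7 * formula_size A) l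
    ((redirect f1 R0 R1 A, b1) :: (redirect f2 T0 T1 A, b2) :: S).
Proof.
move=> r0 r1 s0 s1 eA okS szS l0 l1.
have get T : T \in l -> prove 7 l T.
  by move=> Tl; apply: (@ent_le _ _ 0) => //; apply: ent_sub => x /[!inE] /eqP->.
elim: A eA szS => [|||//|i] /=; try by move=> *; apply: get.
  move=> A IA p B IB /andP[eA eB] szS H.
  have {}IA := IA eA ltac:(nat_lia) ltac:(by move=> i iA; apply: H; rewrite mem_cat iA).
  have {}IB := IB eB ltac:(nat_lia)
    ltac:(by move=> i iB; apply: H; rewrite mem_cat iB orbT).
  apply: (@ent_le _ _ (7 * formula_size A + (7 * formula_size B + 7))); last nat_lia.
  apply: ent_have IA _; apply: (ent_have (ent_weak _ IB)).
    by move=> x; rewrite inE orbC => ->.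
  apply: prove_dec2; rewrite ?redirect_size ?redirect_eDT ?eA ?eB //; first nat_lia.
  - by rewrite !inE eqxx orbT.
  - by rewrite inE eqxx.
by move=> _ _ H; apply: get; apply: H; rewrite inE.
Qed.

(** There are at most [2 * N] extension variables to treat, those of [E] and those of the formula.
    Each takes [7 * N] lines for its body and 5 to unfold it; the last [7 * N] are for the formula
    itself. *)
Definition form_cost := (7 * N + 5) * (2 * N) + 7 * N.

Lemma sync_form f1 f2 R0 R1 T0 T1 b1 b2 S l A :
  atomic R0 -> atomic R1 -> atomic T0 -> atomic T1 ->
  copied f1 R0 R1 -> copied f2 T0 T1 -> is_eDT A -> exts_below M A ->
  formula_size A <= N -> ok m S -> weight S + 4 * N + 8 <= m ->
  (R0, b1) :: (T0, b2) :: S \in l -> (R1, b1) :: (T1, b2) :: S \in l ->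
  prove form_cost l
    ((redirect f1 R0 R1 A, b1) :: (redirect f2 T0 T1 A, b2) :: S).
Proof.
move=> r0 r1 s0 s1 c1 c2 eA bA szA okS szS l0 l1.
have N0 : 0 < N by apply: leq_trans szA; apply: formula_size_gt0.
pose st i : sstate := (Ext (f1 i), b1) :: (Ext (f2 i), b2) :: S.
pose I := iota 0 (size E) ++ exts A.
(* The index itself serves as rank, since the body of e_i mentions only smaller indices. *)
have [|l' e H] := @ent_family _ (sstep E' m) _ id (fun i => i < M) st
    (7 * N + 5) l I.
  move=> x l' xI xM sub H; rewrite /st.
  have szx := size_nth_ext x N0; have ex := eDT_nth_ext x.
  apply: (prove_unfold2 (c := 7 * N) (c1 _ xM) (c2 _ xM)).
  - by rewrite !redirect_eDT // ex.
  - by rewrite !redirect_size //; nat_lia.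
  have lez : 7 * formula_size (nth Zero E x) <= 7 * N by nat_lia.
  apply: ent_le lez; apply: sync_redirect => //; [nat_lia|exact: sub..|].
  (* A variable without an axiom in [E] has the default body 0, which mentions no variables. *)
  case: (ltnP x (size E)) => xE; last by rewrite nth_default.
  have := wfE (onth_some Zero xE); rewrite exts_belowE => /allP below i /below ix.
  by apply: H => //; rewrite ?mem_cat ?mem_iota; nat_lia.
have szI : size I <= 2 * N.
  by rewrite size_cat size_iota; have := size_exts A; nat_lia.
apply: (@ent_le _ _ ((7 * N + 5) * size I + 7 * formula_size A)); last first.
  by rewrite /form_cost leq_add // leq_mul2l ?szI ?orbT.
have e2 : prove (7 * formula_size A) (l' ++ l)
    ((redirect f1 R0 R1 A, b1) :: (redirect f2 T0 T1 A, b2) :: S).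
  apply: sync_redirect; rewrite ?mem_cat ?l0 ?l1 ?orbT //; first nat_lia.
  move=> i iA; rewrite mem_cat H //; first by rewrite mem_cat iA orbT.
  by move: bA; rewrite exts_belowE => /allP; apply.
by apply: (ent_mono (ent_trans e e2)) => // x /[!inE] /eqP->;
  rewrite mem_cat inE eqxx orbT.
Qed.

(** This is charged once per symbol of a query: a formula uses at most [form_cost], a binary
    connective only the 5 lines of [prove_unfold2]. *)
Definition query_cost := form_cost + 10.

(* Two compilations of Q always reach corresponding sinks. *)
Lemma sync_query Q R0 R1 X T0 T1 Y b1 b2 S l :
  atomic R0 -> atomic R1 -> atomic T0 -> atomic T1 ->
  compiled Q R0 R1 X -> compiled Q T0 T1 Y ->
  query_eDT Q -> query_exts_below M Q -> query_size Q <= N ->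
  ok m S -> weight S + 4 * N + 8 <= m ->
  (R0, b1) :: (T0, b2) :: S \in l -> (R1, b1) :: (T1, b2) :: S \in l ->
  prove (query_size Q * query_cost) l ((X, b1) :: (Y, b2) :: S).
Proof.
elim: Q R0 R1 X T0 T1 Y l => [A|P IP|P IP Q IQ|P IP Q IQ]
  R0 R1 X T0 T1 Y l r0 r1 s0 s1 /=.
- move=> [f1 c1 ->] [f2 c2 ->] eA bA szA okS szS l0 l1.
  apply: (@ent_le _ _ form_cost); first exact: sync_form.
  by rewrite (leq_trans (leq_addr 10 _)) // leq_pmull // formula_size_gt0.
- move=> cX cY eP bP szP okS szS l0 l1.
  apply: (@ent_le _ _ (query_size P * query_cost)); last by nat_lia.
  by apply: (IP _ _ _ _ _ _ _ r1 r0 s1 s0 cX cY) => //; nat_lia.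
- move=> [k1 [Z1 [on1 cZ1 cX]]] [k2 [Z2 [on2 cZ2 cY]]].
  move=> /andP[eP eQ] /andP[bP bQ] szPQ okS szS l0 l1.
  (* The inner programs come first: once they are synchronised, their names [Ext k1] and [Ext k2]
     are a valid pair of 0-sinks for the outer programs. *)
  have e1 : prove (query_size Q * query_cost) l ((Z1, b1) :: (Z2, b2) :: S).
    by apply: (IQ R0 R1 Z1 T0 T1 Z2) => //; nat_lia.
  have := compiled_size r0 r1 cZ1; have := compiled_size s0 s1 cZ2 => sz2 sz1.
  have {}e1 := @prove_unfold2 E' m _ k1 Z1 b1 k2 Z2 b2 S l on1 on2
    ltac:(by rewrite (compiled_eDT r0 r1 eQ cZ1) (compiled_eDT s0 s1 eQ cZ2))
    ltac:(nat_lia) e1.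
  have e2 : prove (query_size P * query_cost)
      ([:: (Ext k1, b1), (Ext k2, b2) & S] :: l) ((X, b1) :: (Y, b2) :: S).
    by apply: (IP (Ext k1) R1 X (Ext k2) T1 Y); rewrite ?inE ?l1 ?eqxx ?orbT //; nat_lia.
  by apply: ent_le (ent_have e1 e2) _; rewrite /query_cost; nat_lia.
- move=> [k1 [Z1 [on1 cZ1 cX]]] [k2 [Z2 [on2 cZ2 cY]]].
  move=> /andP[eP eQ] /andP[bP bQ] szPQ okS szS l0 l1.
  have e1 : prove (query_size Q * query_cost) l ((Z1, b1) :: (Z2, b2) :: S).
    by apply: (IQ R0 R1 Z1 T0 T1 Z2) => //; nat_lia.
  have := compiled_size r0 r1 cZ1; have := compiled_size s0 s1 cZ2 => sz2 sz1.
  have {}e1 := @prove_unfold2 E' m _ k1 Z1 b1 k2 Z2 b2 S l on1 on2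
    ltac:(by rewrite (compiled_eDT r0 r1 eQ cZ1) (compiled_eDT s0 s1 eQ cZ2))
    ltac:(nat_lia) e1.
  have e2 : prove (query_size P * query_cost)
      ([:: (Ext k1, b1), (Ext k2, b2) & S] :: l) ((X, b1) :: (Y, b2) :: S).
    by apply: (IP R0 (Ext k1) X T0 (Ext k2) Y); rewrite ?inE ?l0 ?eqxx ?orbT //; nat_lia.
  by apply: ent_le (ent_have e1 e2) _; rewrite /query_cost; nat_lia.
Qed.

End Synchronisation.

(** * Simulations *)

Fixpoint subformulas (A : formula) : seq formula :=
  A :: match A with
       | Dec A _ B | Or A B => subformulas A ++ subformulas B
       | _ => [::]
       end.

Lemma size_subformulas A : size (subformulas A) = formula_size A.
Proof. by elim: A => //= [A HA p B HB|A HA B HB]; rewrite size_cat HA HB. Qed.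

Lemma mem_subformulas A : A \in subformulas A.
Proof. by case: A => *; rewrite mem_head. Qed.

Lemma subformulas_dec A p B C :
  Dec A p B \in subformulas C ->
  (A \in subformulas C) && (B \in subformulas C).
Proof.
elim: C => [||C IC q D ID|C IC D ID|i] //=; rewrite !inE ?mem_cat;
  try by move/eqP.
  case/or3P=> [/eqP[-> _ ->]|/IC|/ID].
  - by rewrite !mem_subformulas !orbT.
  - by move=> /andP[-> ->]; rewrite !orbT.
  - by move=> /andP[-> ->]; rewrite !orbT.
by case/or3P=> [/eqP //|/IC|/ID] /andP[-> ->]; rewrite !orbT.
Qed.

Lemma subformulas_size A B :
  A \in subformulas B -> formula_size A <= formula_size B.
Proof.
by elim: B => //= [||C IC p D ID|C IC D ID|i]; rewrite ?inE ?mem_cat;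
  (try by move/eqP->); case/or3P => [/eqP->//|/IC|/ID] /=; lia.
Qed.

Lemma subformulas_eDT A B : is_eDT B -> A \in subformulas B -> is_eDT A.
Proof.
elim: B => //= [||C IC p D ID|i]; rewrite ?inE ?mem_cat; try by move=> _ /eqP->.
by move=> /andP[eC eD] /or3P[/eqP->|/IC|/ID] /=; rewrite ?eC ?eD //; apply.
Qed.

(* With K larger than every E_i, unfolding e_i decreases the rank. *)
Fixpoint rank (K : nat) (A : formula) : nat :=
  match A with
  | Zero | One => 0
  | Dec A _ B | Or A B => (maxn (rank K A) (rank K B)).+1
  | Ext i => i.+1 * K
  end.

(** Variables below e_i have rank at most [i * K], and the connectives above them add at most the
    depth of [A]. *)
Lemma rank_below K i A : exts_below i A -> rank K A <= i * K + formula_size A.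
Proof.
elim: A => //= [A IA p B IB /andP[/IA a /IB b]|A IA B IB /andP[/IA a /IB b]|j ji].
- by lia.
- by lia.
- by apply: leq_trans (leq_addr _ _); rewrite leq_mul2r ji orbT.
Qed.

(** The two symbols beyond the body make it strictly smaller than [K], which is what lets the rank
    drop at an unfolding. *)
Lemma size_body (E : extensions) A :
  A \in E -> formula_size A + 2 <= extensions_size E.
Proof.
rewrite /extensions_size; elim: E => //= B F IH.
by rewrite inE => /orP[/eqP->|/IH]; lia.
Qed.

Lemma size_all_subformulas (E : extensions) :
  size (flatten (map subformulas E)) <= extensions_size E.
Proof.
rewrite /extensions_size; elim: E => //= C F IH.
by rewrite size_cat size_subformulas; lia.
Qed.

Section Simulation.

Variables (E E' : extensions) (N m : nat).
Hypotheses (wfE : extension_axioms E) (ofE : or_free E)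
  (subE : extensions_sub E E').
Hypotheses (EN : extensions_size E <= N) (mN : 8 * N + 20 <= m).

Lemma simulation_provable A B :
  is_eDT A -> is_eDT B -> formula_size A <= N -> formula_size B <= N ->
  simulates E A B ->
  ent (sstep E' m) (7 * (3 * N * (3 * N))) [::] [:: [:: (A, false); (B, true)]].
Proof.
move=> eA eB szA szB sAB.
(* This list is closed under taking the components of decisions and unfolding variables, so the
   premises of a simulation rule between nodes again relate nodes. *)
pose nodes := subformulas A ++ subformulas B ++ flatten (map subformulas E).
have sznodes : size nodes <= 3 * N.
  rewrite !size_cat !size_subformulas.
  by have := size_all_subformulas E; nat_lia.
have nodeP C : C \in nodes -> is_eDT C && (formula_size C <= N).
  rewrite !mem_cat => /or3P[H|H|/flatten_mapP[D DE H]].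
  - by rewrite (subformulas_eDT eA H) (leq_trans (subformulas_size H)).
  - by rewrite (subformulas_eDT eB H) (leq_trans (subformulas_size H)).
  - rewrite (subformulas_eDT (allP ofE _ DE) H) (leq_trans (subformulas_size H)) //.
    by have := size_body DE; nat_lia.
have node_dec C p D : Dec C p D \in nodes -> (C \in nodes) && (D \in nodes).
  rewrite !mem_cat => /or3P[H|H|/flatten_mapP[F FE H]].
  - by have /andP[-> ->] := subformulas_dec H.
  - by have /andP[-> ->] := subformulas_dec H; rewrite !orbT.
  - have /andP[H1 H2] := subformulas_dec H.
    by apply/andP; split; apply/or3P; apply: Or33; apply/flatten_mapP; exists F.
have node_ext i C : onth E i = Some C -> C \in nodes.
  move=> iC; rewrite !mem_cat; apply/or3P; apply: Or33; apply/flatten_mapP.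
  by exists C; [apply/onthP; exists i|apply: mem_subformulas].
pose K := N.
pose r (x : formula * formula) := rank K x.1 + rank K x.2.
have rank_ext i C : onth E i = Some C -> rank K C < rank K (Ext i).
  move=> iC; have := rank_below K (wfE iC).
  have /size_body : C \in E by apply/onthP; exists i.
  by rewrite /= mulSn /K; nat_lia.
pose st (x : formula * formula) : sstate := [:: (x.1, false); (x.2, true)].
have [|l' e H] := @ent_family _ (sstep E' m) _ r (fun x => simulates E x.1 x.2) st
    7 [::] [seq (C, D) | C <- nodes, D <- nodes].
  move=> [C D] l /allpairsP[[C' D'] /= [Cn Dn [eC eD]]].
  move: eC eD Cn Dn => <- <- {C' D'} Cn Dn sCD _ H.
  have {}H F G : F \in nodes -> G \in nodes -> simulates E F G ->
      rank K F + rank K G < rank K C + rank K D ->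
      [:: (F, false); (G, true)] \in l.
    by move=> Fn Gn sFG rFG; apply: (H (F, G)) => //; apply: allpairs_f.
  have /andP[eC szC] := nodeP _ Cn; have /andP[eD szD] := nodeP _ Dn.
  have okCD : ok m [:: (C, false); (D, true)].
    by rewrite /ok /weight /= eC eD /=; nat_lia.
  rewrite /st /=.
  (* The three rules for disjunction vanish here, because all nodes are eDT formulas. *)
  case: sCD Cn Dn eC eD szC szD okCD H => {C D} //.
  - move=> C Cn _ _ _ _ _ okC _.
    by apply: (@ent_le _ _ 1) => //; apply: (@prove_id _ _ C true);
      rewrite ?inE ?eqxx ?orbT.
  - move=> C i D iD sCD Cn Dn eC eD szC szD okCD H.
    have Dn' := node_ext _ _ iD; have /andP[eD' szD'] := nodeP _ Dn'.
    have okS : ok m [:: (D, true); (C, false); (Ext i, true)].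
      by move: okCD; rewrite /ok /weight /= eC eD' /=; nat_lia.
    apply: (@ent_le _ _ 3) => //; apply: (prove_unfold (b := true) (subE iD)) => //.
      by rewrite !inE eqxx orbT.
    have lT : [:: (C, false); (D, true)] \in l.
      by apply: H => //; rewrite ltn_add2l; apply: rank_ext.
    apply: (prove_hyp _ lT) => //.
    by move=> x; rewrite !inE => /orP[] ->; rewrite ?orbT.
  - move=> C1 D1 C2 D2 p s1 s2 Cn Dn eC eD szC szD okCD H.
    have /andP[C1n D1n] := node_dec _ _ _ Cn.
    have /andP[C2n D2n] := node_dec _ _ _ Dn.
    move: eC eD szC szD => /= /andP[eC1 eD1] /andP[eC2 eD2] szC szD.
    apply: prove_dec2; rewrite ?eC1 ?eD1 ?eC2 ?eD2 //.
    + by rewrite /weight /=; nat_lia.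
    + by apply: H => //=; nat_lia.
    + by apply: H => //=; nat_lia.
  - move=> i C D iC sCD Cn Dn eC eD szC szD okCD H.
    have Cn' := node_ext _ _ iC; have /andP[eC' szC'] := nodeP _ Cn'.
    have okS : ok m [:: (C, false); (Ext i, false); (D, true)].
      by move: okCD; rewrite /ok /weight /= eC' eD /=; nat_lia.
    apply: (@ent_le _ _ 3) => //; apply: (prove_unfold (b := false) (subE iC)) => //.
      by rewrite !inE eqxx.
    have lT : [:: (C, false); (D, true)] \in l.
      by apply: H => //; rewrite ltn_add2r; apply: rank_ext.
    apply: (prove_hyp _ lT) => //.
    by move=> x; rewrite !inE => /orP[] ->; rewrite ?orbT.
apply: (ent_mono e) => //.
  by rewrite size_allpairs leq_mul2l leq_mul // orbT.
move=> x; rewrite inE => /eqP->; apply: (H (A, B)) => //.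
by apply: allpairs_f; rewrite !mem_cat mem_subformulas ?orbT.
Qed.

End Simulation.

(** * From strategies to signed derivations *)

Lemma size_extensions (E : extensions) : size E <= extensions_size E.
Proof. by rewrite /extensions_size; elim: E => //= A E IH; lia. Qed.

Section Refutation.

Variables (E E' : extensions) (M N m : nat) (g : query -> formula).
Hypotheses (wfE : extension_axioms E) (ofE : or_free E)
  (subE : extensions_sub E E') (EM : size E <= M).
Hypotheses (EN : extensions_size E <= N) (mN : 12 * N + 30 <= m).
Hypothesis gform : forall A, g (QForm A) = A.

Implicit Types (S : sstate) (l : seq sstate).

Local Notation prove c l S := (ent (sstep E' m) c l [:: S]).
Local Notation compiled := (compiled E E' M).

Definition represented (Q : query) : Prop :=
  [/\ compiled Q Zero One (g Q), query_eDT Q, query_exts_below M Q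
    & query_size Q <= N].

Lemma represented_eDT Q : represented Q -> is_eDT (g Q).
Proof. by case=> c e _ _; apply: (compiled_eDT _ _ e c). Qed.

Lemma represented_size Q : represented Q -> formula_size (g Q) <= query_size Q.
Proof. by case=> c _ _ _; apply: (compiled_size _ _ c). Qed.

Lemma represented_le Q : represented Q -> formula_size (g Q) <= N.
Proof.
by move=> rQ; apply: leq_trans (represented_size rQ) _; case: rQ.
Qed.

Local Notation qcost := (N * query_cost N).

Lemma prove_sync c0 c1 Q R0 R1 X T0 T1 Y b1 b2 S l :
  atomic R0 -> atomic R1 -> atomic T0 -> atomic T1 ->
  compiled Q R0 R1 X -> compiled Q T0 T1 Y ->
  [&& query_eDT Q, query_exts_below M Q & query_size Q <= N] ->
  ok m S -> weight S <= 2 * N ->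
  prove c0 l ((R0, b1) :: (T0, b2) :: S) ->
  prove c1 l ((R1, b1) :: (T1, b2) :: S) ->
  prove (c0 + c1 + qcost) l ((X, b1) :: (Y, b2) :: S).
Proof.
move=> r0 r1 t0 t1 cX cY /and3P[eQ bQ szQ] okS szS e0 e1.
have lec : c0 + (c1 + query_size Q * query_cost N) <= c0 + c1 + qcost.
  by rewrite addnA leq_add2l leq_mul2r szQ orbT.
apply: ent_le lec; apply: ent_have e0 _; apply: (ent_have (ent_weak _ e1)).
  by move=> x; rewrite inE orbC => ->.
have EN' := leq_trans (size_extensions E) EN.
have bodyN A : A \in E -> formula_size A <= N.
  by move=> /size_body; nat_lia.
apply: (sync_query wfE ofE EM EN' bodyN r0 r1 t0 t1 cX cY) => //.
- by nat_lia.
- by rewrite !inE eqxx orbT.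
- by rewrite inE eqxx.
Qed.

(** Needed because the copy of [Q] inside the program of a compound query is in general not the
    program [g Q]. *)
Lemma prove_same Q X Y b l :
  compiled Q Zero One X -> compiled Q Zero One Y ->
  [&& query_eDT Q, query_exts_below M Q & query_size Q <= N] ->
  prove (2 + qcost) l [:: (X, b); (Y, ~~ b)].
Proof.
move=> cX cY hQ; apply: (@prove_sync 1 1 Q Zero One X Zero One Y) => //.
- apply: (@prove_id _ _ Zero b); rewrite ?inE ?eqxx ?orbT //.
  by rewrite /ok /weight /=; nat_lia.
- apply: (@prove_id _ _ One b); rewrite ?inE ?eqxx ?orbT //.
  by rewrite /ok /weight /=; nat_lia.
Qed.

(** The first summand pays for a simulation. The second pays for two synchronisations, one along the
    outer program and one comparing the inner program with [g Q]. *)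
Definition leaf_cost := 7 * (3 * N * (3 * N)) + 2 * qcost + 20.

(** Closes a branch where an outer program has arrived at the name [Ext k] of its inner program:
    unfold the name and compare the result with [g Q]. *)
Lemma prove_named Q k Y b S l :
  onth E' k = Some Y -> compiled Q Zero One Y -> represented Q ->
  (Ext k, b) \in S -> (g Q, ~~ b) \in S -> ok m S -> weight S + N <= m ->
  prove (5 + qcost) l S.
Proof.
move=> kY cY [cQ eQ bQ szQ] kS QS okS szS.
have eY := compiled_eDT (isT : atomic Zero) (isT : atomic One) eQ cY.
have szY := compiled_size (isT : atomic Zero) (isT : atomic One) cY.
have okYS : ok m ((Y, b) :: S).
  move: okS; rewrite /ok /= eY => /andP[-> _] /=.
  by move: szS; rewrite /weight /=; nat_lia.
apply: (prove_unfold kY kS okYS).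
apply: (prove_weak (prove_same b l cY cQ _)) => //; first by rewrite eQ bQ.
by move=> x; rewrite !inE => /orP[/eqP->|/eqP->]; rewrite ?eqxx ?QS ?orbT.
Qed.

Lemma contradiction_provable (C : state) :
  simple_contradiction E C -> (forall x, x \in C -> represented x.1) ->
  prove leaf_cost [::] [seq (g x.1, x.2) | x <- C].
Proof.
have const (b : bool) S :
    ((if b then Zero else One), b) \in S -> ok m S -> prove 1 [::] S.
  exact: prove_const.
case=> {C}.
- move=> _; rewrite /= gform; apply: (@ent_le _ _ 1);
    last by rewrite /leaf_cost; nat_lia.
  by apply: (const true); rewrite ?inE // /ok /weight /=; nat_lia.
- move=> _; rewrite /= gform; apply: (@ent_le _ _ 1);
    last by rewrite /leaf_cost; nat_lia.
  by apply: (const false); rewrite ?inE // /ok /weight /=; nat_lia.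
- move=> A0 A1 p b0 b1 i c cb rC.
  have [_ /= /andP[e0 e1] _ szD] : represented (QForm (Dec A0 p A1)).
    by apply: (rC (_, c)); rewrite !inE eqxx !orbT.
  move=> {rC}; rewrite /= !gform; apply: (@ent_le _ _ 3);
    last by rewrite /leaf_cost; nat_lia.
  apply: (@prove_dec _ _ 1 1 A0 p A1 c); rewrite ?inE ?eqxx ?orbT //.
  + by rewrite /ok /weight /= e0 e1 /=; nat_lia.
  + have okS : ok m [:: (A0, c); (pvar p, false); (A0, b0); (A1, b1);
      (pvar p, i); (Dec A0 p A1, c)].
      by rewrite /ok /weight /= e0 e1 /=; nat_lia.
    (* In the branch where [p] is false, either the state says that [p] is true, or [c <> b0] gives
       [A0] both signs. The other branch is symmetric. *)
    case: i cb okS => cb okS.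
      by apply: (@prove_id _ _ (pvar p) true); rewrite ?inE ?eqxx ?orbT.
    apply: (@prove_id _ _ A0 b0) => //; rewrite !inE ?eqxx ?orbT //.
    by case: c b0 cb {okS} => [] [] //; rewrite ?eqxx.
  + have okS : ok m [:: (A1, c); (pvar p, true); (A0, b0); (A1, b1);
      (pvar p, i); (Dec A0 p A1, c)].
      by rewrite /ok /weight /= e0 e1 /=; nat_lia.
    case: i cb okS => cb okS; last first.
      by apply: (@prove_id _ _ (pvar p) true); rewrite ?inE ?eqxx ?orbT.
    apply: (@prove_id _ _ A1 b1) => //; rewrite !inE ?eqxx ?orbT //.
    by case: c b1 cb {okS} => [] [] //; rewrite ?eqxx.
- move=> Q b rC.
  have [cQ eQ bQ szQ] : represented Q.
    by apply: (rC (_, b)); rewrite !inE eqxx.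
  have [/= cN _ _ _] : represented (QNot Q).
    by apply: (rC (_, b)); rewrite !inE eqxx orbT.
  apply: (@ent_le _ _ (1 + 1 + qcost)); last by rewrite /leaf_cost; nat_lia.
  (* The sinks of the two programs are exchanged, so both pairs of sinks consist of 0 and 1 with the
     common sign [b], and one of the two constants closes the sequent. *)
  apply: (prove_sync _ _ _ _ cQ cN) => //; first by rewrite eQ bQ.
  + apply: (const b); first by case: b {rC}; rewrite !inE eqxx ?orbT.
    by rewrite /ok /weight /=; nat_lia.
  + apply: (const b); first by case: b {rC}; rewrite !inE eqxx ?orbT.
    by rewrite /ok /weight /=; nat_lia.
- move=> P Q rC.
  have [[/= [k [Y [kY cY cX]]] _ _ _] rP] : represented (QOr P Q) /\ represented P.
    by split; [apply: (rC (_, false))|apply: (rC (_, true))];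
      rewrite !inE eqxx ?orbT.
  have [cP eP bP szP] := rP.
  apply: (@ent_le _ _ (1 + 1 + qcost)); last by rewrite /leaf_cost; nat_lia.
  apply: (prove_sync _ _ _ _ cX cP) => //; first by rewrite eP bP.
  + by apply: (const true); rewrite ?inE ?eqxx ?orbT // /ok /weight /=; nat_lia.
  + by apply: (const false); rewrite ?inE ?eqxx ?orbT // /ok /weight /=; nat_lia.
- move=> P Q rC.
  have [[/= [k [Y [kY cY cX]]] /andP[eP _] /andP[bP _] szPQ] rQ] :
      represented (QOr P Q) /\ represented Q.
    by split; [apply: (rC (_, false))|apply: (rC (_, true))];
      rewrite !inE eqxx ?orbT.
  have eX := compiled_eDT (isT : atomic (Ext k)) (isT : atomic One) eP cX.
  have szX := compiled_size (isT : atomic (Ext k)) (isT : atomic One) cX.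
  have eQ := represented_eDT rQ.
  have szQ := represented_le rQ.
  apply: (@ent_le _ _ (5 + qcost + 1 + qcost).+1);
    last by rewrite /leaf_cost; nat_lia.
  (* The state contains no program for [P] to follow, so the program for the disjunction is
     duplicated and synchronised with itself down to its sinks [Ext k] and 1. *)
  apply: (@prove_weak _ _ _
    [:: (g (QOr P Q), false); (g (QOr P Q), false); (g Q, true)]).
  + apply: (prove_sync _ _ _ _ cX cX) => //.
    * by rewrite eP bP; nat_lia.
    * by rewrite /ok /weight /= eQ; nat_lia.
    * by rewrite /weight /=; nat_lia.
    * apply: (prove_named (b := false) _ kY cY rQ); rewrite ?inE ?eqxx ?orbT //.
        by rewrite /ok /weight /= eQ; nat_lia.
      by rewrite /weight /=; nat_lia.
    * apply: (const false); rewrite ?inE ?eqxx ?orbT //.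
      by rewrite /ok /weight /= eQ; nat_lia.
  + by move=> x; rewrite !inE => /or3P[] ->; rewrite ?orbT.
  + by rewrite /ok /weight /= eX eQ /=; nat_lia.
- move=> P Q rC.
  have [[/= [k [Y [kY cY cX]]] _ _ _] [rP rQ]] :
      represented (QOr P Q) /\ represented P /\ represented Q.
    by split; [apply: (rC (_, true))|split; apply: (rC (_, false))];
      rewrite !inE eqxx ?orbT.
  have [cP eP bP szP] := rP; have eQ := represented_eDT rQ.
  have szQ := represented_le rQ.
  apply: (@ent_le _ _ (5 + qcost + 1 + qcost)); last by rewrite /leaf_cost; nat_lia.
  apply: (prove_sync _ _ _ _ cX cP) => //.
  + by rewrite eP bP.
  + by rewrite /ok /weight /= eQ; nat_lia.
  + by rewrite /weight /=; nat_lia.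
  + apply: (prove_named (b := true) _ kY cY rQ); rewrite ?inE ?eqxx ?orbT //.
      by rewrite /ok /weight /= eQ; nat_lia.
    by rewrite /weight /=; nat_lia.
  + apply: (const false); rewrite ?inE ?eqxx ?orbT //.
    by rewrite /ok /weight /= eQ; nat_lia.
- move=> P Q rC.
  have [[/= [k [Y [kY cY cX]]] _ _ _] [rP rQ]] :
      represented (QAnd P Q) /\ represented P /\ represented Q.
    by split; [apply: (rC (_, false))|split; apply: (rC (_, true))];
      rewrite !inE eqxx ?orbT.
  have [cP eP bP szP] := rP; have eQ := represented_eDT rQ.
  have szQ := represented_le rQ.
  apply: (@ent_le _ _ (1 + (5 + qcost) + qcost));
    last by rewrite /leaf_cost; nat_lia.
  apply: (prove_sync _ _ _ _ cX cP) => //.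
  + by rewrite eP bP.
  + by rewrite /ok /weight /= eQ; nat_lia.
  + by rewrite /weight /=; nat_lia.
  + apply: (const true); rewrite ?inE ?eqxx ?orbT //.
    by rewrite /ok /weight /= eQ; nat_lia.
  + apply: (prove_named (b := false) _ kY cY rQ); rewrite ?inE ?eqxx ?orbT //.
      by rewrite /ok /weight /= eQ; nat_lia.
    by rewrite /weight /=; nat_lia.
- move=> P Q rC.
  have [[/= [k [Y [kY cY cX]]] _ _ _] rP] : represented (QAnd P Q) /\ represented P.
    by split; [apply: (rC (_, true))|apply: (rC (_, false))];
      rewrite !inE eqxx ?orbT.
  have [cP eP bP szP] := rP.
  apply: (@ent_le _ _ (1 + 1 + qcost)); last by rewrite /leaf_cost; nat_lia.
  apply: (prove_sync _ _ _ _ cX cP) => //; first by rewrite eP bP.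
  + by apply: (const true); rewrite ?inE ?eqxx ?orbT // /ok /weight /=; nat_lia.
  + by apply: (const false); rewrite ?inE ?eqxx ?orbT // /ok /weight /=; nat_lia.
- move=> P Q rC.
  have [[/= [k [Y [kY cY cX]]] /andP[eP _] /andP[bP _] szPQ] rQ] :
      represented (QAnd P Q) /\ represented Q.
    by split; [apply: (rC (_, true))|apply: (rC (_, false))];
      rewrite !inE eqxx ?orbT.
  have eX := compiled_eDT (isT : atomic Zero) (isT : atomic (Ext k)) eP cX.
  have szX := compiled_size (isT : atomic Zero) (isT : atomic (Ext k)) cX.
  have eQ := represented_eDT rQ.
  have szQ := represented_le rQ.
  apply: (@ent_le _ _ (1 + (5 + qcost) + qcost).+1);
    last by rewrite /leaf_cost; nat_lia.
  (* As for the second disjunct, the compound program is synchronised with a copy of itself, now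
     with sinks 0 and [Ext k]. *)
  apply: (@prove_weak _ _ _
    [:: (g (QAnd P Q), true); (g (QAnd P Q), true); (g Q, false)]).
  + apply: (prove_sync _ _ _ _ cX cX) => //.
    * by rewrite eP bP; nat_lia.
    * by rewrite /ok /weight /= eQ; nat_lia.
    * by rewrite /weight /=; nat_lia.
    * apply: (const true); rewrite ?inE ?eqxx ?orbT //.
      by rewrite /ok /weight /= eQ; nat_lia.
    * apply: (prove_named (b := true) _ kY cY rQ); rewrite ?inE ?eqxx ?orbT //.
        by rewrite /ok /weight /= eQ; nat_lia.
      by rewrite /weight /=; nat_lia.
  + by move=> x; rewrite !inE => /or3P[] ->; rewrite ?orbT.
  + by rewrite /ok /weight /= eX eQ /=; nat_lia.
- move=> i A b iA rC.
  have [_ /= eA _ szA] : represented (QForm A).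
    by apply: (rC (_, ~~ b)); rewrite !inE eqxx orbT.
  rewrite /= !gform; apply: (@ent_le _ _ 1);
    last by rewrite /leaf_cost; nat_lia.
  apply: prove_axiom; last by rewrite /ok /weight /= eA; nat_lia.
  by apply: (srule_ext (subE iA) (b := b)); rewrite !inE eqxx ?orbT.
- move=> A B sAB rC.
  have [_ /= eA _ szA] : represented (QForm A).
    by apply: (rC (_, false)); rewrite !inE eqxx.
  have [_ /= eB _ szB] : represented (QForm B).
    by apply: (rC (_, true)); rewrite !inE eqxx orbT.
  rewrite /= !gform.
  apply: (@ent_le _ _ (7 * (3 * N * (3 * N))));
    last by rewrite /leaf_cost; nat_lia.
  by apply: (simulation_provable wfE ofE subE EN) => //; nat_lia.
Qed.

(** A strategy has at most [(strategy_size t).+1] leaves; each leaf adds a weakening to its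
    contradiction, and each inner node is one cut. *)
Definition strategy_cost (t : strategy) : nat := (strategy_size t).+1 * leaf_cost.+1.

Fixpoint queries (t : strategy) : seq query :=
  if t is Node Q t0 t1 then Q :: queries t0 ++ queries t1 else [::].

(** Each query becomes a cut on its program. The bound on weight plus strategy size passes to the
    subtrees, since the label [Q] leaves the tree when [g Q], which is no larger, enters the state;
    hence all lines stay small. *)
Lemma winning_provable (t : strategy) (S : state) :
  (forall x, x \in S -> represented x.1) ->
  (forall Q, Q \in queries t -> represented Q) ->
  weight [seq (g x.1, x.2) | x <- S] + strategy_size t <= N ->
  winning E S t ->
  prove (strategy_cost t) [::] [seq (g x.1, x.2) | x <- S].
Proof.
rewrite /strategy_cost.
have eDTS (S' : state) : (forall x, x \in S' -> represented x.1) ->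
    all (fun x : formula * bool => is_eDT x.1) [seq (g x.1, x.2) | x <- S'].
  move=> rS; apply/allP => _ /mapP[x xS ->] /=.
  by apply: represented_eDT; apply: rS.
elim: t S => [|Q t0 IH0 t1 IH1] S rS rt szS /=.
  move=> [C [sC CS]]; rewrite mul1n.
  have rC x : x \in C -> represented x.1 by move=> /CS /rS.
  apply: prove_weak (contradiction_provable sC rC) _ _.
    by move=> _ /mapP[x xC ->]; apply: map_f; apply: CS.
  by rewrite /ok eDTS //=; nat_lia.
move=> [w0 w1].
have rQ : represented Q by apply: rt; rewrite /= mem_head.
have rQS b x : x \in (Q, b) :: S -> represented x.1.
  by rewrite inE => /orP[/eqP->|/rS].
have szQ := represented_size rQ.
have e0 := IH0 ((Q, false) :: S) (rQS _)
  ltac:(by move=> P Pt; apply: rt; rewrite /= inE mem_cat Pt orbT)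
  ltac:(by move: szS; rewrite /weight /=; nat_lia) w0.
have e1 := IH1 ((Q, true) :: S) (rQS _)
  ltac:(by move=> P Pt; apply: rt; rewrite /= inE mem_cat Pt !orbT)
  ltac:(by move: szS; rewrite /weight /=; nat_lia) w1.
apply: ent_le (prove_cut _ e1 e0) _.
  rewrite -/([seq (g x.1, x.2) | x <- (Q, true) :: S]) /ok eDTS; last exact: rQS.
  by move: szS; rewrite /weight /=; nat_lia.
by rewrite !mulSn !mulnDl; nat_lia.
Qed.

End Refutation.

(** * Existence of the compiled programs *)

Definition wf_extensions (E : extensions) : Prop :=
  extension_axioms E /\ or_free E.

Lemma onth_catl (E L : extensions) : extensions_sub E (E ++ L).
Proof.
by move=> i A; rewrite onth_cat; case: ltnP => // iE; rewrite onth_default.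
Qed.

Lemma wf_cat E L :
  wf_extensions E -> all is_eDT L ->
  (forall i A, onth L i = Some A -> exts_below (size E + i) A) ->
  wf_extensions (E ++ L).
Proof.
move=> [aE oE] oL aL; split; last by rewrite /or_free all_cat (oE : all _ _).
move=> i A; rewrite onth_cat; case: ltnP => iE; first exact: aE.
by move=> /aL; rewrite subnKC.
Qed.

Lemma onth_map_iota (T : Type) (h : nat -> T) M i :
  onth [seq h j | j <- iota 0 M] i = if i < M then Some (h i) else None.
Proof.
case: ltnP => iM; last by rewrite onth_default // size_map size_iota.
rewrite (onth_some (h 0)) ?size_map ?size_iota //.
by rewrite (nth_map 0) ?size_iota // nth_iota.
Qed.

Lemma compiled_mono E E1 E2 M Q R0 R1 X :
  extensions_sub E1 E2 -> compiled E E1 M Q R0 R1 X -> compiled E E2 M Q R0 R1 X.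
Proof.
move=> sub; elim: Q R0 R1 X => [A|P IP|P IP Q IQ|P IP Q IQ] R0 R1 X /=.
- by move=> [f cf ->]; exists f => // i iM; apply: sub; apply: cf.
- exact: IP.
- by move=> [k [Y [kY /IQ cY /IP cX]]]; exists k, Y; split=> //; apply: sub.
- by move=> [k [Y [kY /IQ cY /IP cX]]]; exists k, Y; split=> //; apply: sub.
Qed.

Lemma query_exts_below_leq n n' Q :
  n <= n' -> query_exts_below n Q -> query_exts_below n' Q.
Proof.
move=> nn; elim: Q => [A|P IP|P IP Q IQ|P IP Q IQ] /=; [|exact: IP|..].
- exact: exts_below_leq.
- by move=> /andP[/IP -> /IQ ->].
- by move=> /andP[/IP -> /IQ ->].
Qed.

Lemma query_exts_bounded Q : exists n, query_exts_below n Q.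
Proof.
elim: Q => [A|P [n HP]|P [n HP] Q [n' HQ]|P [n HP] Q [n' HQ]] /=.
- exists (\max_(i <- exts A) i).+1; rewrite exts_belowE; apply/allP => i iA.
  by rewrite ltnS; apply: (@leq_bigmax_seq _ _ xpredT id).
- by exists n.
- by exists (maxn n n'); rewrite (query_exts_below_leq (leq_maxl _ _) HP)
    (query_exts_below_leq (leq_maxr _ _) HQ).
- by exists (maxn n n'); rewrite (query_exts_below_leq (leq_maxl _ _) HP)
    (query_exts_below_leq (leq_maxr _ _) HQ).
Qed.

(** Queries may mention extension variables that have no axiom in [E]; the copies must reach far
    enough to include these too. *)
Lemma queries_exts_bounded k (qs : seq query) :
  exists2 n, k <= n & all (query_exts_below n) qs.
Proof.
elim: qs => [|Q qs [n kn Hn]] /=; first by exists k.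
have [n' HQ] := query_exts_bounded Q.
exists (maxn n n'); first by rewrite leq_max kn.
rewrite (query_exts_below_leq (leq_maxr _ _) HQ) /=.
by apply/allP => P /(allP Hn); apply: query_exts_below_leq; apply: leq_maxl.
Qed.

Section Compilation.

Variables (E : extensions) (M : nat).
Hypothesis wfE : wf_extensions E.

Lemma exts_below_nth i : exts_below i (nth Zero E i).
Proof.
case: (ltnP i (size E)) => iE; last by rewrite nth_default.
by apply: (proj1 wfE); apply: onth_some.
Qed.

(** The copy is appended to [F] with all indices shifted by the length of [F]. Bodies then refer to
    earlier variables of the copy, or to [R0] and [R1], which live below it. *)
Lemma copy_exists F R0 R1 :
  wf_extensions F -> atomic R0 -> atomic R1 ->
  exts_below (size F) R0 -> exts_below (size F) R1 ->
  exists L f, [/\ wf_extensions (F ++ L), copied E (F ++ L) M f R0 R1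
    & forall i, i < M -> f i < size (F ++ L)].
Proof.
move=> wfF a0 a1 b0 b1; set s := size F.
exists [seq redirect (addn s) R0 R1 (nth Zero E i) | i <- iota 0 M], (addn s).
split.
- apply: wf_cat => //.
    apply/allP => _ /mapP[i _ ->]; rewrite redirect_eDT //.
    by apply: eDT_nth_ext; apply: (proj2 wfE).
  move=> i A; rewrite onth_map_iota; case: ltnP => // iM [<-].
  have si : s <= s + i by apply: leq_addr.
  apply: redirect_exts_below (exts_below_nth i).
  + by move=> j ji; rewrite ltn_add2l.
  + exact: exts_below_leq b0.
  + exact: exts_below_leq b1.
- move=> i iM; rewrite onth_cat ltnNge leq_addr /= addKn onth_map_iota iM.
  by [].
- by move=> i iM; rewrite size_cat size_map size_iota ltn_add2l.
Qed.

(** For a binary connective the second component is compiled first and named by the next free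
    variable, since that name is a sink of the first. Hence the generality in [F], [R0] and [R1]. *)
Lemma compiled_exists Q F R0 R1 :
  wf_extensions F -> atomic R0 -> atomic R1 ->
  exts_below (size F) R0 -> exts_below (size F) R1 ->
  query_eDT Q -> query_exts_below M Q ->
  exists L X, [/\ wf_extensions (F ++ L), compiled E (F ++ L) M Q R0 R1 X
    & exts_below (size (F ++ L)) X].
Proof.
elim: Q F R0 R1 => [A|P IP|P IP Q IQ|P IP Q IQ] F R0 R1 wfF a0 a1 b0 b1 /=.
- move=> eA bA; have [L [f [wfL cf bf]]] := copy_exists wfF a0 a1 b0 b1.
  have szF : size F <= size (F ++ L) by rewrite size_cat leq_addr.
  exists L, (redirect f R0 R1 A); split=> //; first by exists f.
  apply: redirect_exts_below bA => //; exact: exts_below_leq szF _.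
- by move=> eP bP; apply: IP.
- move=> /andP[eP eQ] /andP[bP bQ].
  have [L1 [Y [wf1 cY bY]]] := IQ F R0 R1 wfF a0 a1 b0 b1 eQ bQ.
  set F1 := F ++ L1 in wf1 cY bY.
  have wf2 : wf_extensions (F1 ++ [:: Y]).
    apply: wf_cat => //; first by rewrite /= (compiled_eDT a0 a1 eQ cY).
    by move=> [|i] A /=; [case=> <-; rewrite addn0|rewrite onth0n].
  have szF : size F <= size (F1 ++ [:: Y]) by rewrite !size_cat -addnA leq_addr.
  have kF : exts_below (size (F1 ++ [:: Y])) (Ext (size F1)).
    by rewrite /= size_cat addn1.
  have [L2 [X [wf3 cX bX]]] := IP (F1 ++ [:: Y]) (Ext (size F1)) R1 wf2 isT a1
    kF (exts_below_leq szF b1) eP bP.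
  exists (L1 ++ [:: Y] ++ L2), X; rewrite !catA -/F1; split=> //.
  exists (size F1), Y; split=> //.
    by apply: onth_catl; rewrite onth_cat ltnn subnn.
  by apply: compiled_mono cY; rewrite -catA; apply: onth_catl.
- move=> /andP[eP eQ] /andP[bP bQ].
  have [L1 [Y [wf1 cY bY]]] := IQ F R0 R1 wfF a0 a1 b0 b1 eQ bQ.
  set F1 := F ++ L1 in wf1 cY bY.
  have wf2 : wf_extensions (F1 ++ [:: Y]).
    apply: wf_cat => //; first by rewrite /= (compiled_eDT a0 a1 eQ cY).
    by move=> [|i] A /=; [case=> <-; rewrite addn0|rewrite onth0n].
  have szF : size F <= size (F1 ++ [:: Y]) by rewrite !size_cat -addnA leq_addr.
  have kF : exts_below (size (F1 ++ [:: Y])) (Ext (size F1)).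
    by rewrite /= size_cat addn1.
  have [L2 [X [wf3 cX bX]]] := IP (F1 ++ [:: Y]) R0 (Ext (size F1)) wf2 a0 isT
    (exts_below_leq szF b0) kF eP bP.
  exists (L1 ++ [:: Y] ++ L2), X; rewrite !catA -/F1; split=> //.
  exists (size F1), Y; split=> //.
    by apply: onth_catl; rewrite onth_cat ltnn subnn.
  by apply: compiled_mono cY; rewrite -catA; apply: onth_catl.
Qed.

(* Extension variables that occur in a query but not in E are set to 0, so
   that every program has its sinks among 0 and 1. *)
Lemma compiled_all_exists (qs : seq query) :
  size E <= M -> all query_eDT qs -> all (query_exts_below M) qs ->
  exists E' g, [/\ wf_extensions E', extensions_sub E E',
    forall A, g (QForm A) = A
    & forall Q, Q \in qs -> compiled E E' M Q Zero One (g Q)].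
Proof.
move=> EM.
(* The strengthening adds the identity copy, through which every formula is its own program, as
   [g (QForm A) = A] demands. *)
suff main : all query_eDT qs -> all (query_exts_below M) qs ->
    exists E' g, [/\ wf_extensions E', extensions_sub E E',
      forall A, g (QForm A) = A, copied E E' M id Zero One
      & forall Q, Q \in qs -> compiled E E' M Q Zero One (g Q)].
  by move=> eqs bqs; have [E' [g [? ? ? _ ?]]] := main eqs bqs; exists E', g.
elim: qs => [_ _|Q qs IH] /=.
  (* Padding with the axioms e_i <-> 0 up to [M] yields the identity copy; on compound queries [g]
     is still arbitrary. *)
  exists (E ++ nseq (M - size E) Zero), (fun Q => if Q is QForm A then A else Zero).
  split=> //.
  - apply: wf_cat => //; first by apply/allP => A; rewrite mem_nseq => /andP[_ /eqP->].
    by move=> i A; rewrite onth_nseq; case: ltnP => // _ [<-].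
  - exact: onth_catl.
  - move=> i iM; rewrite redirect_id onth_cat; case: ltnP => iE.
      exact: onth_some.
    by rewrite onth_nseq ltn_sub2rE // iM nth_default.
move=> /andP[eQ eqs] /andP[bQ bqs].
have [F [g [wfF subF gF idF cF]]] := IH eqs bqs.
have [isF|notF] : (exists A, Q = QForm A) \/ (forall A, QForm A <> Q).
  by case: (Q) => [A|P|P P'|P P']; [left; exists A|right..].
  have [A eQA] := isF; exists F, g; split=> // P; rewrite inE => /orP[/eqP->|/cF //].
  by rewrite eQA gF; exists id => //; rewrite redirect_id.
have [L [X [wfL cX _]]] := @compiled_exists Q F Zero One wfF isT isT isT isT eQ bQ.
exists (F ++ L), (fun P => if P == Q then X else g P); split=> //.
- by move=> i A /subF; apply: onth_catl.
- by move=> A; case: eqP => [/notF//|_]; apply: gF.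
- by move=> i iM; apply: onth_catl; apply: idF.
- move=> P; rewrite inE; case: eqP => [-> _ //|_ /= /cF].
  by apply: compiled_mono; apply: onth_catl.
Qed.

End Compilation.

(** * From signed derivations to sequent derivations *)

Section Structural.

Variables (step : seq sequent -> sequent -> Prop).
Variables (mk : seq formula -> sequent) (okp : pred (seq formula)) (b : nat).
Hypothesis exchange : forall G G' A B, okp (G ++ [:: B; A] ++ G') ->
  step [:: mk (G ++ [:: A; B] ++ G')] (mk (G ++ [:: B; A] ++ G')).
Hypothesis weakening : forall G A, okp (G ++ [:: A]) ->
  step [:: mk G] (mk (G ++ [:: A])).
Hypothesis contraction : forall G A, okp (G ++ [:: A]) ->
  step [:: mk (G ++ [:: A; A])] (mk (G ++ [:: A])).
Hypothesis okp_perm : forall G G', perm_eq G G' -> okp G -> okp G'.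
Hypothesis okp_catl : forall G G', okp (G ++ G') -> okp G.
Hypothesis okp_size : forall G, okp G -> size G <= b.

Lemma ent_comp c1 c2 l s m :
  ent step c1 l [:: s] -> ent step c2 [:: s] m -> ent step (c1 + c2) l m.
Proof.
move=> e1 e2; apply: ent_have e1 _.
by apply: ent_weak e2 => x; rewrite !inE => ->.
Qed.

Lemma ent_step1 s s' : step [:: s] s' -> ent step 1 [:: s] [:: s'].
Proof. by move=> st; apply: ent_step st _; apply: ent_sub. Qed.

Lemma ent_move_front H G1 A G2 :
  okp (H ++ G1 ++ A :: G2) ->
  ent step (size G1) [:: mk (H ++ G1 ++ A :: G2)] [:: mk (H ++ A :: G1 ++ G2)].
Proof.
elim/last_ind: G1 G2 => [|G1 B IH] G2 okG; first exact: ent_sub.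
rewrite size_rcons -addn1 addnC cat_rcons.
apply: (ent_comp (s := mk (H ++ G1 ++ A :: B :: G2))).
  have := @exchange (H ++ G1) G2 B A; rewrite /= -!catA => ex.
  apply: ent_step1; apply: ex; apply: okp_perm okG.
  by rewrite !perm_cat2l -cats1 -catA perm_cat2l (perm_catCA [:: B] [:: A]).
rewrite cat_rcons; apply: IH; apply: okp_perm okG.
by rewrite !perm_cat2l -cats1 -catA perm_cat2l (perm_catCA [:: B] [:: A]).
Qed.

(** Selection sort: the head of the target is brought forward by adjacent exchanges and joins the
    prefix [H], behind which the rest is sorted. *)
Lemma ent_perm H G G' :
  okp (H ++ G) -> perm_eq G G' ->
  ent step (size G * size G) [:: mk (H ++ G)] [:: mk (H ++ G')].
Proof.
elim: G' H G => [|A G' IH] H G okG pG.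
  by have /perm_nilP-> := pG; apply: ent_sub.
have AG : A \in G by rewrite (perm_mem pG) mem_head.
case/splitPr: AG okG pG => G1 G2 okG pG.
have p1 : perm_eq (G1 ++ A :: G2) (A :: G1 ++ G2).
  by rewrite -(cat1s A) (perm_catCA G1 [:: A] G2).
apply: (@ent_le _ _ (size G1 + size (G1 ++ G2) * size (G1 ++ G2))); last first.
  by rewrite !size_cat /=; nia.
apply: ent_comp (ent_move_front okG) _.
have := IH (H ++ [:: A]) (G1 ++ G2); rewrite -!catA; apply.
  by apply: okp_perm okG; rewrite perm_cat2l.
by rewrite -(perm_cons A); apply: perm_trans pG; rewrite perm_sym.
Qed.

Lemma ent_perm_le G G' :
  okp G -> perm_eq G G' -> ent step (b * b) [:: mk G] [:: mk G'].
Proof.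
move=> okG pG; apply: ent_le (@ent_perm [::] G G' okG pG) _.
by rewrite leq_mul ?okp_size.
Qed.

Lemma ent_weaken G G' :
  okp (G ++ G') -> ent step (size G') [:: mk G] [:: mk (G ++ G')].
Proof.
elim: G' G => [|A G' IH] G okG; first by rewrite cats0; apply: ent_sub.
rewrite -cat1s catA; apply: (ent_comp (c1 := 1) (s := mk (G ++ [:: A]))).
  apply: ent_step1; apply: weakening.
  by apply: (@okp_catl _ G'); rewrite -catA.
by apply: IH; rewrite -catA.
Qed.

(** Each member of [G] is moved to the end next to its twin from [G'], contracted, and the list
    restored: two permutations and one contraction. *)
Lemma ent_contract G G' :
  okp (G ++ G') -> {subset G <= G'} ->
  ent step (size G * (2 * (b * b) + 1)) [:: mk (G ++ G')] [:: mk G'].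
Proof.
elim: G => [|A G IH] okG sub; first exact: ent_sub.
have AG' : A \in G' by apply: sub; rewrite mem_head.
have pG' := perm_to_rem AG'.
have okG1 : okp (G ++ G').
  apply: (@okp_catl _ [:: A]); apply: okp_perm okG.
  by rewrite cat_cons perm_sym perm_catC.
have p1 : perm_eq (A :: G ++ G') ((G ++ rem A G') ++ [:: A; A]).
  rewrite perm_sym perm_catC /= perm_cons -[A :: _]cat1s perm_catCA perm_cat2l.
  by rewrite perm_sym.
have p2 : perm_eq ((G ++ rem A G') ++ [:: A]) (G ++ G').
  by rewrite -catA perm_cat2l perm_catC /= perm_sym.
have ok2 : okp ((G ++ rem A G') ++ [:: A]).
  by apply: okp_perm okG1; rewrite perm_sym.
apply: (@ent_le _ _ (b * b + (1 + (b * b + size G * (2 * (b * b) + 1))))).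
  apply: ent_comp (ent_perm_le okG p1) _.
  apply: ent_comp (ent_step1 (contraction ok2)) _.
  apply: ent_comp (ent_perm_le ok2 p2) _.
  by apply: IH => // x xG; apply: sub; rewrite inE xG orbT.
by rewrite /=; nat_lia.
Qed.

Definition structural_cost := b + b * (2 * (b * b) + 1).

(** All of [G'] is appended by weakening, then [G] is absorbed into it. The intermediate list is
    [G ++ G'], which is why [okp] is required of that. *)
Lemma ent_structural G G' :
  okp (G ++ G') -> {subset G <= G'} ->
  ent step structural_cost [:: mk G] [:: mk G'].
Proof.
move=> okG sub; have := okp_size okG; rewrite size_cat => szG.
apply: ent_le (ent_comp (ent_weaken okG) (ent_contract okG sub)) _.
by rewrite leq_add ?leq_mul //; nat_lia.
Qed.

End Structural.

(** * Signed rules as short sequent derivations *)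

Definition seq_ok (b : nat) (s : sequent) : bool :=
  eDT_sequent s && (sequent_size s <= b).

Definition lstep (E : extensions) (b : nat) (prems : seq sequent) (s : sequent) :=
  seq_ok b s /\ ((prems = [::] /\ extension_hyp E s) \/ LDT_rule prems s).

Lemma size_le_sizes (G : seq formula) : size G <= sumn (map formula_size G).
Proof. by elim: G => //= A G IH; have := formula_size_gt0 A; lia. Qed.

Lemma formula_size_le_sizes A (G : seq formula) :
  A \in G -> formula_size A <= sumn (map formula_size G).
Proof. by elim: G => //= B G IH; rewrite inE => /orP[/eqP->|/IH]; lia. Qed.

Lemma perm_sizes (G G' : seq formula) :
  perm_eq G G' -> sumn (map formula_size G) = sumn (map formula_size G').
Proof. by move=> pG; apply: perm_sumn; apply: perm_map. Qed.

(** One side is treated after the other. The bound doubles because intermediate sequents contain the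
    old and the new list together. *)
Lemma lstep_weaken E h G D G' D' :
  seq_ok h (G, D) -> seq_ok h (G', D') -> {subset G <= G'} -> {subset D <= D'} ->
  ent (lstep E (2 * h)) (2 * structural_cost (2 * h)) [:: (G, D)] [:: (G', D')].
Proof.
rewrite /seq_ok /eDT_sequent /sequent_size /=.
move=> /andP[/andP[eG eD] szGD] /andP[/andP[eG' eD'] szGD'] sG sD.
rewrite [X in ent _ X]mul2n -[X in ent _ X]addnn; apply: (ent_comp (s := (G', D))).
  apply: (@ent_structural _ (fun F => (F, D)) (fun F => seq_ok (2 * h) (F, D)))
    => //.
  - move=> F F' A B okF; split; [exact: okF|right; exact: LDT_exchange_l].
  - move=> F A okF; split; [exact: okF|right; exact: LDT_weak_l].
  - move=> F A okF; split; [exact: okF|right; exact: LDT_contr_l].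
  - move=> F F' pF; rewrite /seq_ok /eDT_sequent /sequent_size /=.
    by rewrite (perm_all _ pF) (perm_sizes pF).
  - move=> F F'; rewrite /seq_ok /eDT_sequent /sequent_size /=.
    by rewrite all_cat map_cat sumn_cat => /andP[/andP[/andP[-> _] ->]] /=; lia.
  - move=> F; rewrite /seq_ok /sequent_size /= => /andP[_].
    by have := size_le_sizes F; nat_lia.
  - rewrite /seq_ok /eDT_sequent /sequent_size /= all_cat eG eG' eD /=.
    by rewrite map_cat sumn_cat; nat_lia.
apply: (@ent_structural _ (fun F => (G', F)) (fun F => seq_ok (2 * h) (G', F)))
  => //.
- move=> F F' A B okF; split; [exact: okF|right; exact: LDT_exchange_r].
- move=> F A okF; split; [exact: okF|right; exact: LDT_weak_r].
- move=> F A okF; split; [exact: okF|right; exact: LDT_contr_r].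
- move=> F F' pF; rewrite /seq_ok /eDT_sequent /sequent_size /=.
  by rewrite (perm_all _ pF) (perm_sizes pF).
- move=> F F'; rewrite /seq_ok /eDT_sequent /sequent_size /=.
  by rewrite all_cat map_cat sumn_cat => /andP[/andP[-> /andP[-> _]]] /=; lia.
- move=> F; rewrite /seq_ok /sequent_size /= => /andP[_].
  by have := size_le_sizes F; nat_lia.
- rewrite /seq_ok /eDT_sequent /sequent_size /= all_cat eD eG' eD' /=.
  by rewrite map_cat sumn_cat; nat_lia.
Qed.

Definition sequent_of (S : sstate) : sequent :=
  ([seq x.1 | x <- S & x.2], [seq x.1 | x <- S & ~~ x.2]).

Lemma mem_antecedent A S : (A \in (sequent_of S).1) = ((A, true) \in S).
Proof.
rewrite /sequent_of /=; apply/mapP/idP => [[[B b]]|AS].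
  by rewrite mem_filter /= => /andP[bT BS] ->; case: b bT BS.
by exists (A, true) => //; rewrite mem_filter.
Qed.

Lemma mem_succedent A S : (A \in (sequent_of S).2) = ((A, false) \in S).
Proof.
rewrite /sequent_of /=; apply/mapP/idP => [[[B b]]|AS].
  by rewrite mem_filter /= => /andP[bT BS] ->; case: b bT BS.
by exists (A, false) => //; rewrite mem_filter.
Qed.

Lemma sequent_of_size S : sequent_size (sequent_of S) = (weight S).+1.
Proof.
rewrite /sequent_size /sequent_of /weight /=; congr _.+1.
by elim: S => [|[A []] S IH] //=; rewrite -IH; lia.
Qed.

Lemma sequent_of_eDT S :
  eDT_sequent (sequent_of S) = all (fun x => is_eDT x.1) S.
Proof.
rewrite /eDT_sequent /sequent_of /=.
by elim: S => [|[A []] S IH] //=; rewrite -IH; case: is_eDT; rewrite ?andbF.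
Qed.

Lemma ok_sequent_of m S : ok m S -> seq_ok m.+1 (sequent_of S).
Proof.
by rewrite /ok /seq_ok sequent_of_eDT sequent_of_size ltnS.
Qed.

Lemma seq_ok_leq b b' s : b <= b' -> seq_ok b s -> seq_ok b' s.
Proof. by move=> bb /andP[e sz]; rewrite /seq_ok e (leq_trans sz). Qed.

Lemma sequent_of_true A S :
  sequent_of ((A, true) :: S) = (A :: (sequent_of S).1, (sequent_of S).2).
Proof. by []. Qed.

Lemma sequent_of_false A S :
  sequent_of ((A, false) :: S) = ((sequent_of S).1, A :: (sequent_of S).2).
Proof. by []. Qed.

Definition line_cost (m : nat) : nat :=
  8 * structural_cost (2 * (2 * m + 4)) + 2.

(** Each signed rule is one axiom or rule of the calculus surrounded by at most three uses of
    [lstep_weaken]: one per premise to put the active formulas last, one to merge the principal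
    formula with its occurrence in the context. *)
Lemma srule_lstep E m prems S :
  sstep E m prems S -> all (ok m) prems ->
  ent (lstep E (2 * (2 * m + 4))) (line_cost m)
    (map sequent_of prems) [:: sequent_of S].
Proof.
(* This leaves room for the whole state and a second copy of the principal formula. *)
set h := 2 * m + 4; move=> [rS okS] okP; rewrite /line_cost -/h.
set w := structural_cost (2 * h).
case GDE: (sequent_of S) => [G D].
have inG A : (A \in G) = ((A, true) \in S) by rewrite -mem_antecedent GDE.
have inD A : (A \in D) = ((A, false) \in S) by rewrite -mem_succedent GDE.
have := ok_sequent_of okS; rewrite GDE /seq_ok /eDT_sequent /sequent_size /=.
move=> /andP[/andP[eG eD] szGD].
have okGD : seq_ok h (G, D).
  by rewrite /seq_ok /eDT_sequent /sequent_size /= eG eD /=; nat_lia.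
have okh G' D' : seq_ok h (G', D') -> seq_ok (2 * h) (G', D').
  by move=> /andP[e sz]; rewrite /seq_ok e /=; nat_lia.
have ax G' D' : {subset G' <= G} -> {subset D' <= D} -> seq_ok h (G', D') ->
    lstep E (2 * h) [::] (G', D') -> ent (lstep E (2 * h)) (8 * w + 2) [::] [:: (G, D)].
  move=> sG sD okG' st; apply: (@ent_le _ _ (1 + 2 * w)); last by nat_lia.
  apply: (ent_comp (s := (G', D'))).
    by apply: ent_step st _; apply: ent_sub.
  exact: lstep_weaken.
have small A : A \in G \/ A \in D -> is_eDT A && (formula_size A <= m).
  case=> AF; have := formula_size_le_sizes AF; rewrite ?(allP eG _ AF) ?(allP eD _ AF) /=; nat_lia.
have wk l G1 D1 G2 D2 : (G1, D1) \in l -> seq_ok h (G1, D1) -> seq_ok h (G2, D2) ->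
    {subset G1 <= G2} -> {subset D1 <= D2} ->
    ent (lstep E (2 * h)) (2 * w) l [:: (G2, D2)].
  move=> l1 ok1 ok2 sG sD; apply: ent_weak (lstep_weaken E ok1 ok2 sG sD).
  by move=> x; rewrite inE => /eqP->.
have okE G' D' : seq_ok h (G', D') =
    [&& all is_eDT G', all is_eDT D'
      & (sumn (map formula_size G') + sumn (map formula_size D')).+1 <= h].
  by rewrite /seq_ok /eDT_sequent /sequent_size /= -andbA.
have consl (A : formula) F : {subset A :: F <= F ++ [:: A]}.
  by move=> x; rewrite mem_cat !inE orbC.
have catl (F F' : seq formula) : {subset F <= F ++ F'}.
  by move=> x xF; rewrite mem_cat xF.
have snoc (A : formula) F : A \in F -> {subset F ++ [:: A] <= F}.
  by move=> AF x; rewrite mem_cat inE => /orP[//|/eqP->].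
have cons2l (A B : formula) F : {subset [:: A, B & F] <= F ++ [:: A; B]}.
  by move=> x; rewrite mem_cat !inE => /or3P[] ->; rewrite ?orbT.
have cons2r (A B : formula) F : {subset [:: A, B & F] <= F ++ [:: B; A]}.
  by move=> x; rewrite mem_cat !inE => /or3P[] ->; rewrite ?orbT.
case: rS okP GDE inG inD {okS} => {prems S}.
- move=> S S' sub /= /andP[okS _] GDE inG inD.
  apply: (@ent_le _ _ (2 * w)); last by nat_lia.
  case GDE': (sequent_of S) => [G' D']; apply: lstep_weaken => //.
  + by rewrite -GDE'; apply: seq_ok_leq (ok_sequent_of okS); nat_lia.
  + by move=> A; rewrite inG => AG'; apply: sub; rewrite -mem_antecedent GDE'.
  + by move=> A; rewrite inD => AD'; apply: sub; rewrite -mem_succedent GDE'.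
- move=> A S AT AF _ GDE inG inD; have AG : A \in G by rewrite inG.
  have /andP[eA szA] := small A (or_introl AG).
  have okA : seq_ok h ([:: A], [:: A]) by rewrite okE /= eA /=; nat_lia.
  apply: (ax [:: A] [:: A]) => //.
  + by move=> x; rewrite inE => /eqP->.
  + by move=> x; rewrite inE => /eqP->; rewrite inD.
  + by split; [exact: okh|right; exact: LDT_id].
- move=> S ZS _ GDE inG inD.
  apply: (ax [:: Zero] [::]) => //.
  + by move=> x; rewrite inE => /eqP->; rewrite inG.
  + by rewrite okE /=; nat_lia.
  + by split; [apply: okh; rewrite okE /=; nat_lia|right; exact: LDT_zero_l].
- move=> S OS _ GDE inG inD.
  apply: (ax [::] [:: One]) => //.
  + by move=> x; rewrite inE => /eqP->; rewrite inD.
  + by rewrite okE /=; nat_lia.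
  + by split; [apply: okh; rewrite okE /=; nat_lia|right; exact: LDT_one_r].
- move=> A S /= /and3P[ok1 _ _] GDE inG inD.
  move: (ok_sequent_of ok1); rewrite !(sequent_of_true, sequent_of_false) GDE /=.
  rewrite /seq_ok /eDT_sequent /sequent_size /=.
  move=> /andP[/andP[/andP[eA _] _] szA].
  apply: (@ent_le _ _ (2 * w + (2 * w + 0)).+1); last by nat_lia.
  apply: (ent_step (prems := [:: (G, D ++ [:: A]); (G ++ [:: A], D)])).
    by split; [apply: okh|right; apply: LDT_cut].
  apply: ent_cons; [|apply: ent_cons; last exact: ent_sub].
  + apply: (wk _ G (A :: D)); rewrite ?inE ?eqxx ?orbT // okE /=
      ?all_cat ?map_cat ?sumn_cat /= eG eD eA /=; nat_lia.
  + apply: (wk _ (A :: G) D); rewrite ?inE ?eqxx ?orbT // okE /=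
      ?all_cat ?map_cat ?sumn_cat /= eG eD eA /=; nat_lia.
- move=> A p B [] S DS /= /and3P[ok1 ok2 _] GDE inG inD.
  + move: (ok_sequent_of ok1) (ok_sequent_of ok2).
    rewrite !(sequent_of_true, sequent_of_false) GDE /=.
    rewrite /seq_ok /eDT_sequent /sequent_size /=.
    move=> /andP[/andP[/andP[eA _] _] szA] /andP[/andP[/andP[eB _] _] szB].
    have DG : Dec A p B \in G by rewrite inG.
    have /andP[_ /= szAB] := small _ (or_introl DG).
    have okD : seq_ok h (G ++ [:: Dec A p B], D).
      by rewrite okE all_cat map_cat sumn_cat /= eG eD eA eB /=; nat_lia.
    apply: (@ent_le _ _ ((2 * w + (2 * w + 0)).+1 + 2 * w)); last by nat_lia.
    apply: (ent_comp (s := (G ++ [:: Dec A p B], D))); last first.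
      by apply: wk okD okGD _ _ => //; rewrite ?inE //; apply: snoc.
    apply: (ent_step (prems := [:: (G ++ [:: A], D ++ [:: pvar p]);
      (G ++ [:: pvar p; B], D)])).
      by split; [apply: okh|right; apply: LDT_dec_l].
    apply: ent_cons; [|apply: ent_cons; last exact: ent_sub].
    * apply: (wk _ (A :: G) (pvar p :: D)); rewrite ?inE ?eqxx ?orbT // okE /=
        ?all_cat ?map_cat ?sumn_cat /= eG eD eA /=; nat_lia.
    * apply: (wk _ [:: B, pvar p & G] D); rewrite ?inE ?eqxx ?orbT // okE /=
        ?all_cat ?map_cat ?sumn_cat /= eG eD eB /=; nat_lia.
  + move: (ok_sequent_of ok1) (ok_sequent_of ok2).
    rewrite !(sequent_of_true, sequent_of_false) GDE /=.
    rewrite /seq_ok /eDT_sequent /sequent_size /=.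
    move=> /andP[/andP[_ /andP[eA _]] szA] /andP[/andP[_ /andP[eB _]] szB].
    have DD : Dec A p B \in D by rewrite inD.
    have /andP[_ /= szAB] := small _ (or_intror DD).
    have okD : seq_ok h (G, D ++ [:: Dec A p B]).
      by rewrite okE all_cat map_cat sumn_cat /= eG eD eA eB /=; nat_lia.
    apply: (@ent_le _ _ ((2 * w + (2 * w + 0)).+1 + 2 * w)); last by nat_lia.
    apply: (ent_comp (s := (G, D ++ [:: Dec A p B]))); last first.
      by apply: wk okD okGD _ _ => //; rewrite ?inE //; apply: snoc.
    apply: (ent_step (prems := [:: (G, D ++ [:: A; pvar p]);
      (G ++ [:: pvar p], D ++ [:: B])])).
      by split; [apply: okh|right; apply: LDT_dec_r].
    apply: ent_cons; [|apply: ent_cons; last exact: ent_sub].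
    * apply: (wk _ G [:: A, pvar p & D]); rewrite ?inE ?eqxx ?orbT // okE /=
        ?all_cat ?map_cat ?sumn_cat /= eG eD eA /=; nat_lia.
    * apply: (wk _ (pvar p :: G) (B :: D)); rewrite ?inE ?eqxx ?orbT // okE /=
        ?all_cat ?map_cat ?sumn_cat /= eG eD eB /=; nat_lia.
- move=> i A [] S iA iS AS _ GDE inG inD.
  + have AD : A \in D by rewrite inD.
    have /andP[eA szA] := small A (or_intror AD).
    have okA : seq_ok h ([:: Ext i], [:: A]) by rewrite okE /= eA /=; nat_lia.
    apply: (ax [:: Ext i] [:: A]) => //.
    * by move=> x; rewrite inE => /eqP->; rewrite inG.
    * by move=> x; rewrite inE => /eqP->.
    * by split; [exact: okh|left; split=> //; apply: hyp_unfold].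
  + have AG : A \in G by rewrite inG.
    have /andP[eA szA] := small A (or_introl AG).
    have okA : seq_ok h ([:: A], [:: Ext i]) by rewrite okE /= eA /=; nat_lia.
    apply: (ax [:: A] [:: Ext i]) => //.
    * by move=> x; rewrite inE => /eqP->.
    * by move=> x; rewrite inE => /eqP->; rewrite inD.
    * by split; [exact: okh|left; split=> //; apply: hyp_fold].
Qed.

(** * Polynomial bounds *)

(** Truncating the derivation right after an occurrence of [s] makes [s] the last line, and each
    remaining line has at most [b] symbols. *)
Lemma ent_eLDT_proof E b c s :
  ent (lstep E b) c [::] [:: s] ->
  exists2 pi, eLDT_proof E pi s & eLDT_size pi <= c * b.
Proof.
move=> [pi [v szc sub]].
have spi : s \in pi by have := sub s; rewrite inE eqxx cats0; apply.
case/splitPr: spi v szc {sub} => pi1 pi2; rewrite -cat_rcons => /valid_catl v szc.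
have lines pi' x pi'' : rcons pi1 s = pi' ++ x :: pi'' ->
    exists2 prems, lstep E b prems x & {subset prems <= pi'}.
  move=> e; move: v; rewrite e => /valid_split [prems st sub].
  by exists prems => // y /sub; rewrite cats0.
exists (rcons pi1 s).
  split; last by exists pi1.
  move=> pi' x pi'' /lines [prems [/andP[ex _] st] sub]; split=> //.
  by case: st => [[_ hx]|st]; [left|right; exists prems].
apply: (@leq_trans (size (rcons pi1 s) * b)); last first.
  by rewrite leq_mul2r (leq_trans _ szc) ?orbT // size_cat leq_addr.
have bnd x : x \in rcons pi1 s -> sequent_size x <= b.
  move=> xpi; case/splitPr E12: {1}_ / xpi => [pi' pi''].
  by have [prems [/andP[_ ->] _] _] := lines _ _ _ E12.
rewrite /eLDT_size; elim: (rcons pi1 s) bnd => //= x qs IH bnd.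
rewrite mulSn leq_add ?bnd ?mem_head // IH // => y yqs.
by apply: bnd; rewrite inE yqs orbT.
Qed.

Definition polynomial (f : nat -> nat) : Prop :=
  exists P : {poly nat}, forall N, P.[N]%R = f N.

Lemma polynomial_const c : polynomial (fun=> c).
Proof. by exists (c%:P)%R => N; rewrite hornerC. Qed.

Lemma polynomial_id : polynomial id.
Proof. by exists 'X%R => N; rewrite hornerX. Qed.

Lemma polynomial_add f h :
  polynomial f -> polynomial h -> polynomial (fun N => f N + h N).
Proof. by move=> [P HP] [Q HQ]; exists (P + Q)%R => N; rewrite hornerD HP HQ. Qed.

Lemma polynomial_succ f : polynomial f -> polynomial (fun N => (f N).+1).
Proof.
move=> pf; have [P HP] := polynomial_add pf (polynomial_const 1).
by exists P => N; rewrite HP addn1.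
Qed.

Lemma polynomial_mul f h :
  polynomial f -> polynomial h -> polynomial (fun N => f N * h N).
Proof. by move=> [P HP] [Q HQ]; exists (P * Q)%R => N; rewrite hornerM HP HQ. Qed.

(** Sequents per signed line, times the number of signed lines, times the size of one sequent, with
    signed lines bounded by [m = 12 * N + 30]. *)
Definition proof_bound (N : nat) : nat :=
  line_cost (12 * N + 30) * (N.+1 * (leaf_cost N).+1) * (2 * (2 * (12 * N + 30) + 4)).

Lemma polynomial_proof_bound : polynomial proof_bound.
Proof.
rewrite /proof_bound /line_cost /structural_cost /leaf_cost /query_cost /form_cost.
by do ! first [ exact: polynomial_const | exact: polynomial_id
  | apply: polynomial_succ | apply: polynomial_add | apply: polynomial_mul ].
Qed.

Lemma query_size_strategy t Q :
  Q \in queries t -> query_size Q <= strategy_size t.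
Proof.
elim: t => //= P t0 IH0 t1 IH1; rewrite inE mem_cat.
by case/or3P => [/eqP->|/IH0|/IH1]; nat_lia.
Qed.

Lemma queries_eDT t : strategy_eDT t -> all query_eDT (queries t).
Proof.
by elim: t => //= Q t0 IH0 t1 IH1 /and3P[-> e0 e1]; rewrite all_cat IH0 ?IH1.
Qed.

Lemma sequent_of_initial_state (g : query -> formula) Gamma Delta :
  (forall A, g (QForm A) = A) ->
  sequent_of [seq (g x.1, x.2) | x <- initial_state (Gamma, Delta)]
    = (Gamma, Delta).
Proof.
move=> gform; rewrite /sequent_of /initial_state /= map_cat !filter_cat !map_cat.
congr pair.
  rewrite -[RHS]cats0; congr (_ ++ _).
    by elim: Gamma => //= A G ->; rewrite gform.
  by elim: Delta.
rewrite -[RHS]cat0s; congr (_ ++ _).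
  by elim: Gamma.
by elim: Delta => //= A G ->; rewrite gform.
Qed.

Theorem theorem4p5 :
  exists P : {poly nat},
    forall (E : extensions) (Gamma Delta : seq formula) (t : strategy) (N : nat),
      extension_axioms E -> or_free E -> eDT_sequent (Gamma, Delta) ->
      DB_proof E t (Gamma, Delta) -> DB_size E t (Gamma, Delta) = N ->
      exists (E' : extensions) (pi : seq sequent),
        extension_axioms E' /\ or_free E' /\ extensions_sub E E' /\
        eLDT_proof E' pi (Gamma, Delta) /\ eLDT_size pi <= P.[N]%R.
Proof.
have [P PE] := polynomial_proof_bound; exists P => E Gamma Delta t N aE oE eGD.
move=> [et win]; rewrite /DB_size PE => sizeN.
(* The formulas of the end sequent also occur in the states, so they too must be represented. *)
pose qs := queries t ++ map fst (initial_state (Gamma, Delta)).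
have initP x : x \in initial_state (Gamma, Delta) ->
    exists A, [/\ x.1 = QForm A, is_eDT A & formula_size A < sequent_size (Gamma, Delta)].
  move: eGD; rewrite /eDT_sequent /sequent_size /= => /andP[/allP eG /allP eD].
  rewrite mem_cat => /orP[] /mapP[A AF ->]; exists A; split=> //=.
  - exact: eG.
  - by have /= := formula_size_le_sizes AF; nat_lia.
  - exact: eD.
  - by have /= := formula_size_le_sizes AF; nat_lia.
(* [M] need not be bounded in terms of [N]. It affects only how many axioms [E'] has, while the
   costs involve just the variables of [E] and of the formula at hand. *)
have [M EM bqs] := queries_exts_bounded (size E) qs.
have eqs : all query_eDT qs.
  rewrite all_cat queries_eDT //=; apply/allP => _ /mapP[x /initP [A [-> eA _]] ->].
  exact: eA.
have [|E' [g [wfE' subE gform cg]]] := @compiled_all_exists E M _ qs EM eqs bqs.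
  by [].
have rep Q : Q \in qs -> represented E E' M N g Q.
  move=> Qqs; split; [exact: cg|exact: (allP eqs)|exact: (allP bqs)|].
  move: Qqs; rewrite mem_cat => /orP[/query_size_strategy|]; first by nat_lia.
  by move=> /mapP[x /initP [A [-> _ szA]] ->] /=; nat_lia.
have seqE := sequent_of_initial_state Gamma Delta gform.
have EN : extensions_size E <= N by nat_lia.
have szw : weight [seq (g x.1, x.2) | x <- initial_state (Gamma, Delta)]
    + strategy_size t <= N.
  have := sequent_of_size [seq (g x.1, x.2) | x <- initial_state (Gamma, Delta)].
  by rewrite seqE; nat_lia.
have repS x : x \in initial_state (Gamma, Delta) -> represented E E' M N g x.1.
  by move=> xS; apply: rep; rewrite mem_cat map_f ?orbT.
have rept Q : Q \in queries t -> represented E E' M N g Q.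
  by move=> Qt; apply: rep; rewrite mem_cat Qt.
have prov := winning_provable aE oE subE EM EN (leqnn (12 * N + 30)) gform
  repS rept szw win.
have /= := ent_translate (fun prems S (st : sstep _ _ prems S) => proj2 st)
  (fun prems S => @srule_lstep E' (12 * N + 30) prems S) prov.
rewrite seqE => /ent_eLDT_proof [pi ppi szpi]; exists E', pi.
case: wfE' => aE' oE'; do !split => //; try by case: ppi.
apply: leq_trans szpi _; rewrite /proof_bound leq_mul2r leq_mul2l /strategy_cost.
by rewrite leq_mul2r ltnS (leq_trans _ (_ : strategy_size t <= N)) ?orbT //; nat_lia.
Qed.
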